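(* Let $g:\mathbb{N}\to[1,\infty)$ be a function such that the sequence $([g(n)])_{n=1}^\infty$ is pointwise ergodic. Let $S_1,\dots,S_k\subseteq\mathbb{N}$ satisfy $\overline{d}(S_i)>0$ for each $i=1,\dots,k$, and put $D_g=\bigcap_{i=1}^k\Delta_{2,g}(S_i)$. Then there is $S\subseteq\mathbb{N}$ with $d(S)\ge\prod_{i=1}^k\overline{d}(S_i)$ and $\Delta_{1,g}(S)\subseteq D_g$; furthermore, $\overline{d}(\Delta_{1,g}(S))\ge\prod_{i=1}^k\overline{d}(S_i)$. If, in addition, the function $g$ comes from a Hardy field and has the property that for some $\ell\in\mathbb{N}\cup\{0\}$, $\lim_{x\to\infty}g^{(\ell)}(x)=\pm\infty$ and $\lim_{x\to\infty}g^{(\ell+1)}(x)=0$, then the set $D_g$ is thick.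
   Context: $\mathbb{N}=\{1,2,3,\dots\}$; $[\cdot]$ is the integral part. For $S\subseteq\mathbb{N}$, $\overline{d}(S)=\limsup_{N\to\infty}|S\cap\{1,\dots,N\}|/N$; $d(S)$ denotes $\lim_{N\to\infty}|S\cap\{1,\dots,N\}|/N$ when this limit exists, and an assertion about $d(S)$ includes that it exists. For $m\in\mathbb{N}$, $S-m=\{j\in\mathbb{N}:j+m\in S\}$. For $S\subseteq\mathbb{N}$, $\Delta_{1,g}(S)=\{n\in\mathbb{N}:S\cap(S-[g(n)])\ne\emptyset\}$ and $\Delta_{2,g}(S)=\{n\in\mathbb{N}:\overline{d}(S\cap(S-[g(n)]))>0\}$. A set $D\subseteq\mathbb{N}$ is thick if for all $n\in\mathbb{N}$ there is $a\in\mathbb{N}$ with $\{a,a+1,\dots,a+n\}\subseteq D$. A measure-preserving system is $(X,\mathcal{B},\mu,T)$ with $(X,\mathcal{B},\mu)$ a probability space and $T:X\to X$ a measurable map with $\mu(T^{-1}A)=\mu(A)$ for all $A\in\mathcal{B}$; it is invertible if $T$ is invertible, and ergodic if the only $T$-invariant sets (sets $A$ with $1_A=1_{T^{-1}A}$ a.e.) have measure $0$ or $1$. A sequence $(a_n)_{n=1}^\infty$ in $\mathbb{N}$ is pointwise ergodic if for every ergodic invertible measure-preserving system $(X,\mathcal{B},\mu,T)$ and every $f\in L^2(\mu)$, $\lim_{N\to\infty}\frac1N\sum_{n=1}^Nf(T^{a_n}x)=\int f\,d\mu$ for almost every $x\in X$. Let $B$ be the ring (under pointwise operations) of germs at infinity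 of continuous real functions on $[1,\infty)$ (two functions have the same germ if they agree for all sufficiently large arguments). A Hardy field is a subfield of $B$ closed under differentiation. ''$g$ comes from a Hardy field'' means that $g$ is given by a real function on $[1,\infty)$ whose germ belongs to some Hardy field; $g^{(\ell)}$ denotes the $\ell$-th derivative of this function (with $g^{(0)}=g$). *)

(* Defs.v *)
From HB Require Import structures.
From mathcomp Require Export all_boot all_order all_algebra.
From mathcomp Require Export all_classical all_reals all_analysis.
Export Order.TTheory GRing.Theory Num.Theory.
Export numFieldNormedType.Exports.

Set Implicit Arguments.
Unset Strict Implicit.
Unset Printing Implicit Defensive.

Local Open Scope classical_set_scope.
Local Open Scope ring_scope.

(* Subsets of {1, 2, 3, ...} are values of [set nat] contained in [posN];
   sequences indexed by {1, 2, 3, ...} are functions on [nat] whose value at 0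
   is never used. *)
Definition posN : set nat := [set n | (0 < n)%N].

Section Density.
Variable R : realType.

Definition freq (S : set nat) (N : nat) : R :=
  (\sum_(1 <= n < N.+1 | n \in S) 1)%N%:R / N%:R.

(* [freq S] takes values in [0, 1], so its limsup is a real number (and the
   real-valued [limn_sup] is meaningful). *)
Definition upper_density (S : set nat) : R := limn_sup (freq S).

Definition has_density (S : set nat) (x : R) : Prop := freq S @ \oo --> x.

End Density.

Definition shift_down (S : set nat) (m : nat) : set nat :=
  [set j | (0 < j)%N /\ S (j + m)%N].

Section Delta.
Variable R : realType.

(* On [0, +oo[, [Num.truncn] is the integral part. *)
Definition intpart (g : nat -> R) (n : nat) : nat := Num.truncn (g n).

Definition Delta1 (g : nat -> R) (S : set nat) : set nat :=
  [set n | (0 < n)%N /\ S `&` shift_down S (intpart g n) !=set0].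

Definition Delta2 (g : nat -> R) (S : set nat) : set nat :=
  [set n | (0 < n)%N /\
           0 < upper_density R (S `&` shift_down S (intpart g n))].

End Delta.

Definition thick (D : set nat) : Prop :=
  forall n : nat, (0 < n)%N ->
    exists a : nat, (0 < a)%N /\ forall i : nat, (i <= n)%N -> D (a + i)%N.

Section Ergodic.
Variables (R : realType) (d : measure_display) (X : measurableType d).
Variables (mu : probability X R) (T : X -> X).

Definition measure_preserving : Prop :=
  measurable_fun setT T /\
  forall A : set X, measurable A -> mu (T @^-1` A) = mu A.

(* Invertibility is in the category of measurable spaces. *)
Definition invertible : Prop :=
  exists T' : X -> X, [/\ measurable_fun setT T', cancel T T' & cancel T' T].

Definition ergodic : Prop :=
  forall A : set X, measurable A ->
    {ae mu, forall x, \1_A x = \1_(T @^-1` A) x :> R} ->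
    mu A = 0%E \/ mu A = 1%E.

End Ergodic.

Definition pointwise_ergodic (R : realType) (a : nat -> nat) : Prop :=
  forall (d : measure_display) (X : measurableType d) (mu : probability X R)
         (T : X -> X),
    measure_preserving mu T -> invertible T -> ergodic mu T ->
    forall f : X -> R, f \in Lfun mu 2%:E ->
      {ae mu, forall x,
         (N%:R^-1 * \sum_(1 <= n < N.+1) f (iter (a n) T x)) @[N --> \oo]
           --> \int[mu]_y f y}.

Section Hardy.
Variable R : realType.

(* Functions on [1, +oo[ are given by total functions [R -> R]; the values
   outside [1, +oo[ are irrelevant. *)
Definition same_germ (f h : R -> R) : Prop := \forall x \near +oo, f x = h x.

(* A set of germs of continuous functions is represented by the set [H] of all
   representatives of its members, i.e. by a set of functions continuous on
   [1, +oo[ that is saturated for [same_germ].  The last four clauses say that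
   the set of germs is a subfield of the ring of germs; the derivative is that
   of the germ, hence only required to exist at infinity. *)
Record hardy_field (H : set (R -> R)) : Prop := HardyField {
  hardy_continuous : forall f : R -> R, H f -> {within `[1, +oo[, continuous f};
  hardy_saturated : forall f h : R -> R, H f ->
    {within `[1, +oo[, continuous h} -> same_germ f h -> H h;
  hardy_derive : forall f : R -> R, H f ->
    exists h : R -> R, H h /\ \forall x \near +oo, is_derive x (1 : R) f (h x);
  hardy_one : H (fun=> 1);
  hardy_sub : forall f h : R -> R, H f -> H h -> H (f \- h);
  hardy_mul : forall f h : R -> R, H f -> H h -> H (f \* h);
  hardy_inv : forall f : R -> R, H f -> ~ same_germ f (fun=> 0) ->
    exists h : R -> R, H h /\ same_germ (f \* h) (fun=> 1)
}.

Definition germ_in_hardy_field (G : R -> R) : Prop :=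
  exists H : set (R -> R), hardy_field H /\
    exists f : R -> R, H f /\ same_germ G f.

End Hardy.

(* Main.v *)
From HB Require Import structures.
Require Import Defs.
From mathcomp Require Import measurable_realfun lra ring zify.

(** Let M be the set of m >= 1 such that every S_i meets its translate S_i - m
    in a set of positive upper density, so that n is in D_g exactly when
    [g(n)] is in M, and let c be the product of the upper densities.  Averaging
    over translates of the S_i gives, for every N, a set F inside [0, N) with
    at least c N elements and all differences in M ([shrink_bigcap]).  Both
    halves of the theorem are derived from these finite sets.

    First half.  The statistics of the sets F have a limit, a shift invariant
    law on {0,1}^Z giving mass at least c to x_0 = 1 and mass zero to
    x_0 = x_m = 1 whenever m is not in M.  The laws with the second property
    form a compact convex set; maximising first the mass of x_0 = 1 and then,
    one after the other, the masses of all cylinders, singles out an extreme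
    one ([exists_extreme_law]).  It is realised by a probability measure, the
    image of Lebesgue measure on [0, 1) under a coding by nested intervals
    ([law_measure_cyl]), and extremality makes the shift ergodic
    ([law_measure_ergodic]).  For a typical point x with x_0 = 1 put
    S = {n >= 1 : x_{n-1} = 1}.  Birkhoff's theorem for an indicator
    ([birkhoff_indicator]) gives S a density equal to the mass of x_0 = 1, and
    the differences of S lie in M because null cylinders are avoided.  As 1 is
    in S, every n with x_{[g(n)]} = 1 lies in Delta_1(S); pointwise ergodicity
    of [g(n)] says that these n have the same density.

    Second half.  It has to be shown that [g(a)], ..., [g(a+n)] all lie in M
    for some a ([exists_pattern]).  The autocorrelation of F is a combination
    of cosines with nonnegative coefficients and constant term at least c/2,
    and it vanishes at positive integers outside M.  Multiplied by a power of
    (1 + cos 2 pi t) / 2 it becomes small at every real t that is not close to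
    an element of M.  The product E of n+1 copies of a high power of it is
    again a positive combination of cosines, and its constant term is larger
    than any value which E takes at a point with a bad coordinate.  So it is
    enough to find a finite average over a for which the mean of
    cos (sum_i theta_i (g(a+i) - delta)) is at least - e, uniformly in bounded
    theta ([equidistribution]): then the mean of E exceeds its bad values.

    Near a base point A the function g is a polynomial of degree l up to a
    small error, because its derivative of order l+1 tends to zero; and since
    the derivative of order l tends to infinity with small increments, base
    points can be chosen at which it follows any prescribed arithmetic
    progression.  With phi_m = sum_i theta_i i^m the phase is the sum over m of
    phi_m times the m-th Taylor coefficient at a.  If phi_m is not small,
    differencing l - m times removes the uncontrolled lower coefficients
    ([weyl]) and leaves a geometric sum over the progression, which is small.
    If all phi_m are tiny, the phase is tiny and its cosine is positive.  In
    between nothing can be said, but a number phi_m is in between for only one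
    of many widely separated scales, so averaging over scales finishes the
    proof ([many_scales]). *)

Set Implicit Arguments.
Unset Strict Implicit.
Unset Printing Implicit Defensive.

Local Open Scope classical_set_scope.
Local Open Scope ring_scope.

(** * Upper densities and sets with prescribed differences *)

Section BoundedLimsup.
Variables (R : realType) (u : nat -> R).
Hypothesis u01 : forall n, 0 <= u n <= 1.

Let u_bounded : bounded_fun (u : R^o^nat).
Proof.
exists 1; split; first exact: num_real.
move=> x x1 n _ /=; have /andP[u0 u1] := u01 n.
by rewrite ger0_norm// (le_trans u1)// ltW.
Qed.

Lemma limn_supE01 : limn_sup u = inf (range (sups u)).
Proof. exact: limn_supE. Qed.

Let sups_inf : has_inf (range (sups u)).
Proof.
split; first by exists (sups u 0%N); exists 0%N.
exact: bounded_fun_has_lbound_sups.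
Qed.

Lemma near_lt_limn_sup e : 0 < e -> \forall n \near \oo, u n < limn_sup u + e.
Proof.
move=> e0; rewrite limn_supE01.
have [_ [n _ <-] hn] := inf_adherent e0 sups_inf.
near=> m; apply: le_lt_trans hn; apply: ub_le_sup.
  exact/has_ubound_sdrop/bounded_fun_has_ubound.
by exists m => //=; near: m; exists n.
Unshelve. all: by end_near. Qed.

Lemma exists_gt_limn_sup e N : 0 < e ->
  exists2 n, (N <= n)%N & limn_sup u - e < u n.
Proof.
move=> e0; rewrite limn_supE01; apply: contrapT => h.
have : inf (range (sups u)) <= inf (range (sups u)) - e.
  apply: le_trans (_ : sups u N <= _); first by apply: (ge_inf sups_inf.2); exists N.
  apply: ge_sup; first by exists (u N); exists N => /=.
  move=> _ [n /= Nn <-]; rewrite leNgt; apply/negP => lt_n.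
  by apply: h; exists n.
lra.
Qed.

Lemma cvg_le_limn_sup (v : nat -> R) x : (forall n, v n <= u n) ->
  v @ \oo --> x -> x <= limn_sup u.
Proof.
move=> vu vx; apply/ler_addgt0Pr => e e0.
have : \forall n \near \oo, v n <= limn_sup u + e.
  near=> n; apply: le_trans (vu n) _.
  by apply: ltW; near: n; exact: near_lt_limn_sup.
exact: cvgr_to_le.
Unshelve. all: by end_near. Qed.

End BoundedLimsup.

Section Density.
Variable R : realType.
Implicit Types (S : set nat) (N L : nat).

Lemma freqE S N : freq R S N = (\sum_(1 <= n < N.+1) (n \in S)%:R) / N%:R.
Proof.
rewrite /freq; congr (_ / _); rewrite natr_sum big_mkcond /=.
by apply: eq_bigr => n _; case: (n \in S).
Qed.

Lemma sum_freq S N : \sum_(1 <= n < N.+1) (n \in S)%:R = N%:R * freq R S N.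
Proof.
rewrite freqE; case: N => [|N]; first by rewrite big_geq// mul0r.
by rewrite mulrC divfK// pnatr_eq0.
Qed.

Lemma freq01 S N : 0 <= freq R S N <= 1.
Proof.
rewrite freqE; case: N => [|N]; first by rewrite big_geq// mul0r ler01 lexx.
rewrite divr_ge0 ?sumr_ge0//= ler_pdivrMr ?ltr0n// mul1r.
apply: le_trans (_ : \sum_(1 <= n < N.+2) 1 <= _).
  by apply: ler_sum => n _; case: (_ \in _).
by rewrite sumr_const_nat subn1.
Qed.

Lemma sum_shift_dist (f : nat -> R) L y : (forall t, 0 <= f t <= 1) ->
  `|\sum_(1 <= t < L.+1) f (t + y)%N - \sum_(1 <= t < L.+1) f t| <= y%:R.
Proof.
move=> f01; elim: y => [|y IH].
  by under eq_bigr do rewrite addn0; rewrite subrr normr0.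
have h : \sum_(1 <= t < L.+1) f (t + y.+1)%N =
         \sum_(1 <= t < L.+1) f (t + y)%N + f (L.+1 + y)%N - f (1 + y)%N.
  elim: (L) => [|l]; first by rewrite !big_geq//; lra.
  rewrite !(@big_nat_recr _ _ _ l.+1)//= => ->.
  rewrite [(l.+1 + y.+1)%N]addnS -addSn; lra.
rewrite h -natr1; move: (f01 (L.+1 + y)%N) (f01 (1 + y)%N) IH.
rewrite !ler_norml; lra.
Qed.

(** Discreteness of the integers: it turns bounds valid up to every positive
    error into exact ones in [shrink]. *)
Lemma nat_gap (r : R) : exists2 e : R, 0 < e & forall q : nat, q%:R < r -> q%:R <= r - e.
Proof.
have [r0|r0] := ltP r 0.
  by exists 1 => // q hq; have := ler0n R q; lra.
have [q0 hq0 lt_q0]: exists2 q0 : nat, q0%:R >= r & forall q : nat, q%:R < r -> (q < q0)%N.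
  exists (Num.truncn r).+1; first by apply: ltW; rewrite truncnS_gt.
  move=> q hq; rewrite ltnS -(ler_nat R).
  by rewrite ler_nat -ltnS -(ltr_nat R) (lt_trans hq)// truncnS_gt.
elim: q0 hq0 lt_q0 => [|q0 IH] hq0 lt_q0.
  by exists 1 => // q /lt_q0.
have [le|lt] := leP r q0%:R.
  apply: IH => // q hq; rewrite -(ltr_nat R); exact: lt_le_trans hq le.
exists (r - q0%:R); first lra.
by move=> q /lt_q0; rewrite ltnS -(ler_nat R) => h; lra.
Qed.

(** Averaging the number of points of Y in S - t over 1 <= t <= L gives about
    d |Y| for suitable large L, where d is the upper density of S. A translate
    showing two points of Y at a distance m for which S meets S - m in density
    zero occurs for a proportion of t tending to 0, so such t may be
    discarded. *)
Lemma shrink S N (Y : {set 'I_N}) :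
  exists Y' : {set 'I_N}, [/\ Y' \subset Y,
    upper_density R S * #|Y|%:R <= #|Y'|%:R &
    forall x y : 'I_N, x \in Y' -> y \in Y' -> (x < y)%N ->
      0 < upper_density R (S `&` shift_down S (y - x)%N)].
Proof.
set d := upper_density R S; apply: contrapT => noY'.
have [Y0|Ypos] := leP (d * #|Y|%:R) 0.
  apply: noY'; exists finset.set0; rewrite cards0 finset.sub0set; split=> // x y.
  by rewrite inE.
pose bad (x y : 'I_N) := (x < y)%N && ~~ `[< 0 < upper_density R (S `&` shift_down S (y - x)%N) >].
pose good (t : nat) := [forall x, forall y, bad x y ==> ~~ ((t + x \in S)%N && (t + y \in S)%N)].
pose Yt (t : nat) := [set y in Y | (t + y \in S)%N]%SET.
have [e e0 gap] := nat_gap (d * #|Y|%:R).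
have Yt_small t : good t -> #|Yt t|%:R <= d * #|Y|%:R - e.
  move=> gt; apply: gap; rewrite ltNge; apply/negP => big.
  apply: noY'; exists (Yt t); split=> //.
    by apply/fintype.subsetP => y; rewrite inE => /andP[].
  move=> x y; rewrite !inE => /andP[_ xS] /andP[_ yS] xy.
  apply: contrapT => nb; move/forallP/(_ x)/forallP/(_ y): gt.
  rewrite /bad xy xS yS /= implybF => /negP; apply.
  by apply/negP => /asboolP.
have N0 : (0 < N)%N.
  rewrite lt0n; apply/eqP => N0; move: Ypos; suff -> : #|Y| = 0%N by rewrite mulr0 ltxx.
  by apply/eqP; rewrite -leqn0 -[X in (_ <= X)%N]N0 -[X in (_ <= X)%N]card_ord max_card.
have NR : 1 <= N%:R :> R by rewrite ler1n.
set P : R := N%:R + N%:R ^+ 3.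
have P0 : 2 <= P by rewrite /P; have := exprn_ege1 3 NR; lra.
have [h h0 hE] : exists2 h : R, 0 < h & h * P = e / 4.
  exists (e / (4 * P)); first by rewrite divr_gt0//; lra.
  by field; rewrite gt_eqF//; lra.
have [L1 hL1] : exists L1, forall L, (L1 <= L)%N ->
   forall x y, bad x y -> freq R (S `&` shift_down S (y - x)%N) L <= h.
  have H x y : exists L1, forall L, (L1 <= L)%N -> bad x y ->
      freq R (S `&` shift_down S (y - x)%N) L <= h.
    have [bxy|nb] := boolP (bad x y); last by exists 0%N.
    have [L1 _ H] := near_lt_limn_sup (freq01 (S `&` shift_down S (y - x)%N)) h0.
    exists L1 => L L1L _; apply: ltW (lt_le_trans (H L L1L) _).
    move: bxy => /andP[_ /asboolPn/negP]; rewrite -leNgt /upper_density; lra.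
  have [f Hf] := choice (fun p => H p.1 p.2).
  exists (\max_p f p) => L maxL x y; apply: (Hf (x, y)).
  by apply: leq_trans maxL; exact: leq_bigmax.
pose L2 := (Num.truncn (N%:R / h)).+1.
have [L L12 hL] := exists_gt_limn_sup (freq01 S) (maxn L1 L2) h0.
have [L1L L2L] : (L1 <= L)%N /\ (L2 <= L)%N by move: L12; rewrite geq_max => /andP.
have NLh : N%:R <= h * L%:R.
  rewrite mulrC -ler_pdivrMr// (le_trans (ltW (truncnS_gt _)))//.
  by rewrite ler_nat.
have L0 : 0 < L%:R :> R by rewrite ltr0n (leq_trans _ L2L).
have upper : \sum_(1 <= t < L.+1) (good t)%:R * #|Yt t|%:R <= L%:R * (d * #|Y|%:R - e).
  have -> : L%:R * (d * #|Y|%:R - e) = \sum_(1 <= t < L.+1) (d * #|Y|%:R - e).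
    by rewrite sumr_const_nat subn1 /= mulr_natl.
  apply: ler_sum => t _; case: (boolP (good t)) => [gt|_].
    by rewrite mul1r Yt_small.
  by rewrite mul0r; apply: (gap 0%N).
(* [B t] counts the forbidden pairs seen from [t]; it is at least 1 when [t]
   is not good, so subtracting [#|Y| * B t] compensates for all bad [t]. *)
pose B t : R := \sum_x \sum_(y | bad x y) ((t + x)%N \in S `&` shift_down S (y - x)%N)%:R.
have YtE t : (0 < t)%N -> \sum_(y in Y) ((t + y)%N \in S)%:R - #|Y|%:R * B t <= (good t)%:R * #|Yt t|%:R.
  move=> t0; have YtE : #|Yt t|%:R = \sum_(y in Y) ((t + y)%N \in S)%:R :> R.
    rewrite -sum1_card natr_sum big_mkcond [RHS]big_mkcond /=.
    by apply: eq_bigr => y _; rewrite inE; case: (y \in Y) => //=; case: (_ \in S).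
  have B0 : 0 <= B t by apply: sumr_ge0 => x _; apply: sumr_ge0.
  case: (boolP (good t)) => [_|].
    by rewrite mul1r YtE gerBl mulr_ge0.
  rewrite negb_forall => /existsP[x]; rewrite negb_forall => /existsP[y].
  rewrite negb_imply negbK => /and3P[bxy xS yS].
  rewrite mul0r -YtE subr_le0.
  have B1 : 1 <= B t.
    rewrite /B (bigD1 x)//= (bigD1 y)//=.
    have -> : (t + x)%N \in S `&` shift_down S (y - x)%N.
      move/andP: bxy => [xy _]; apply/mem_set; split; first exact: set_mem xS.
      by split; [rewrite addn_gt0 t0|rewrite -addnA subnKC ?(ltnW xy)//; exact: set_mem yS].
    by rewrite -addrA lerDl addr_ge0// sumr_ge0// => z _; apply: sumr_ge0.
  apply: le_trans (_ : #|Y|%:R * 1 <= _); last by rewrite ler_wpM2l.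
  rewrite mulr1 ler_nat; apply/subset_leq_card/fintype.subsetP => z.
  by rewrite inE => /andP[].
have cY : #|Y|%:R <= N%:R :> R by rewrite ler_nat -[X in (_ <= X)%N]card_ord max_card.
have BL : \sum_(1 <= t < L.+1) B t <= N%:R ^+ 2 * (2 * h * L%:R).
  rewrite exchange_big /=.
  have -> : N%:R ^+ 2 * (2 * h * L%:R) = \sum_(x < N) \sum_(y < N) (2 * h * L%:R).
    by rewrite !sumr_const card_ord -mulrnA -[RHS]mulr_natl natrM expr2.
  apply: ler_sum => x _; rewrite exchange_big /= big_mkcond; apply: ler_sum => y _.
  have hL0 : 0 <= 2 * h * L%:R by rewrite !mulr_ge0 ?ler0n ?(ltW h0).
  case: ifPn => // bxy; set S' := _ `&` _.
  have S'01 t : 0 <= (t \in S')%:R :> R /\ (t \in S')%:R <= 1 :> R by case: (_ \in _); rewrite ?lexx ?ler01.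
  have := @sum_shift_dist (fun t => (t \in S')%:R) L x (fun t => introT andP (S'01 t)).
  rewrite /= (sum_freq S') ler_norml => /andP[_]; have := hL1 L L1L x y bxy; rewrite -/S' => hf.
  have : L%:R * freq R S' L <= h * L%:R by rewrite mulrC ler_wpM2r// ltW.
  have : x%:R <= N%:R :> R by rewrite ler_nat ltnW.
  move: NLh. lra.
have lower : #|Y|%:R * (d - 2 * h - N%:R ^+ 2 * (2 * h)) * L%:R <= \sum_(1 <= t < L.+1) (good t)%:R * #|Yt t|%:R.
  apply: le_trans (ler_sum_nat (fun t ht => YtE t (proj1 (andP ht)))).
  rewrite sumrB exchange_big /= -mulr_sumr.
  have Sy (y : 'I_N) : (d - 2 * h) * L%:R <= \sum_(1 <= t < L.+1) ((t + y)%N \in S)%:R.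
    have S01 t : 0 <= (t \in S)%:R :> R /\ (t \in S)%:R <= 1 :> R by case: (_ \in _); rewrite ?lexx ?ler01.
    have := @sum_shift_dist (fun t => (t \in S)%:R) L y (fun t => introT andP (S01 t)).
    rewrite /= (sum_freq S) ler_norml => /andP[+ _].
    have : (d - h) * L%:R <= L%:R * freq R S L by rewrite mulrC ler_wpM2l// ltW.
    have : y%:R <= N%:R :> R by rewrite ler_nat ltnW.
    move: NLh; lra.
  have : #|Y|%:R * ((d - 2 * h) * L%:R) <= \sum_(y in Y) \sum_(1 <= t < L.+1) ((t + y)%N \in S)%:R.
    by rewrite mulr_natl -sumr_const; apply: ler_sum => y _.
  have : #|Y|%:R * (\sum_(1 <= t < L.+1) B t) <= #|Y|%:R * (N%:R ^+ 2 * (2 * h * L%:R)) by rewrite ler_wpM2l.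
  lra.
have : e * L%:R <= (N%:R * (2 * h + N%:R ^+ 2 * (2 * h))) * L%:R.
  have : #|Y|%:R * (2 * h + N%:R ^+ 2 * (2 * h)) <= N%:R * (2 * h + N%:R ^+ 2 * (2 * h)).
    by rewrite ler_wpM2r// addr_ge0// ?mulr_ge0// ?exprn_ge0// ltW.
  move=> /(ler_wpM2r (ltW L0)); move: upper lower; lra.
rewrite ler_pM2r//.
have -> : N%:R * (2 * h + N%:R ^+ 2 * (2 * h)) = 2 * (h * P) by rewrite /P; ring.
rewrite hE.
lra.
Qed.

(** Starting from [0, N), each S_i shrinks the current set by at most the
    factor given by its own upper density. *)
Lemma shrink_bigcap k (S_ : 'I_k -> set nat) N :
  exists F : {set 'I_N},
    (\prod_(i < k) upper_density R (S_ i)) * N%:R <= #|F|%:R /\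
    forall x y : 'I_N, x \in F -> y \in F -> (x < y)%N ->
      forall i, 0 < upper_density R (S_ i `&` shift_down (S_ i) (y - x)%N).
Proof.
elim: k S_ => [|k IH] S_.
  exists [set: 'I_N]%SET; split; first by rewrite big_ord0 mul1r cardsT card_ord.
  by move=> x y _ _ _ [].
have [F [cF dF]] := IH (fun i => S_ (lift ord0 i)).
have [F' [F'F cF' dF']] := shrink (S_ ord0) F.
exists F'; split.
  rewrite big_ord_recl -mulrA; apply: le_trans cF'; apply: ler_wpM2l => //.
  have := @cvg_le_limn_sup R _ (freq01 (S_ ord0)) (fun=> 0) 0 _ (cvg_cst 0).
  by apply=> n; case/andP: (freq01 (S_ ord0) n).
move=> x y xF yF xy i; case: (unliftP ord0 i) => [j ->|->]; last exact: dF'.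
by apply: dF => //; apply: (fintype.subsetP F'F).
Qed.

End Density.

(** * Stationary laws on two-sided binary sequences *)

Section Compactness.
Variables (R : realType) (C : eqType).
Implicit Types (P : set (C -> R)) (q : C -> R).

(** Adherence to [P] in the product topology, in elementary terms. *)
Definition approximable P q := forall (l : seq C) (e : R), 0 < e ->
  exists2 q', P q' & forall s, s \in l -> `|q' s - q s| <= e.

Lemma approximableS P P' q : P `<=` P' -> approximable P q -> approximable P' q.
Proof. by move=> PP' hq l e e0; have [q' /PP' ? ?] := hq l e e0; exists q'. Qed.

(** Tychonoff's theorem for the cube [0, 1]^C. *)
Lemma cluster_family (P : nat -> set (C -> R)) :
  (forall n q, P n q -> forall s, 0 <= q s <= 1) ->
  (forall n, P n !=set0) -> (forall n, P n.+1 `<=` P n) ->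
  exists q, forall n, approximable (P n) q.
Proof.
move=> P01 Pne Pdec.
have Pmono m n : (m <= n)%N -> P n `<=` P m.
  elim: n => [|n IH]; first by rewrite leqn0 => /eqP ->.
  by rewrite leq_eqVlt => /orP[/eqP ->//|/IH h] x /Pdec/h.
have cpt : @compact (prod_topology (fun _ : C => R)) [set q | forall s, (`[0, 1]%classic : set R) (q s)].
  exact: (@tychonoff C (fun=> R) (fun=> `[0, 1]%classic) (fun=> @segment_compact R 0 1)).
pose Fl : set_system (prod_topology (fun _ : C => R)) := filter_from setT P.
have FF : ProperFilter Fl.
  apply: filter_from_proper => // ; apply: filter_from_filter; first by exists 0%N.
  move=> m n _ _; exists (maxn m n) => // q Pq.
  by split; apply: Pmono Pq; rewrite ?leq_maxl ?leq_maxr.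
have [] := cpt Fl FF.
  by exists 0%N => // q /P01 Pq s; rewrite /= in_itv /=; exact: Pq.
move=> q [_ clq]; exists q => n l e e0.
pose B (l : seq C) : set (prod_topology (fun _ : C => R)) :=
  [set q' | forall s, s \in l -> `|q' s - q s| <= e].
suff nb : nbhs (q : prod_topology (fun _ : C => R)) (B l).
  have [q' [Pq' hq']] := clq _ _ (ex_intro2 _ _ n I (@subset_refl _ (P n))) nb.
  by exists q'.
elim: l => [|s l IH].
  have -> : B [::] = setT by apply/seteqP; split.
  exact: filterT.
have hs : nbhs (q : prod_topology (fun _ : C => R)) (B [:: s]).
  have -> : B [:: s] = proj s @^-1` [set y : R | `|y - q s| <= e].
    apply/seteqP; split=> q' /=; first by apply; rewrite inE.
    by move=> h s'; rewrite inE => /eqP ->.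
  apply: (@proj_continuous C (fun=> R) s q).
  by apply/nbhs_ballP; exists e => //= y /ltW; rewrite distrC.
have -> : B (s :: l) = B [:: s] `&` B l.
  apply/seteqP; split=> q'.
    by move=> h; split=> s' s'l; apply: h; rewrite inE; [move: s'l; rewrite inE => ->|rewrite s'l orbT].
  by move=> [h1 h2] s'; rewrite inE => /orP[/eqP ->|/h2//]; apply: h1; rewrite inE.
exact: filterI.
Qed.

End Compactness.

Notation cylinder := (seq (int * bool)).

Section Laws.
Variables (R : realType) (M : nat -> Prop).

(** The points with prescribed values at finitely many coordinates;
    prescriptions may be repeated or contradictory. *)
Definition cyl (s : cylinder) : set (int -> bool) :=
  [set x | all (fun p => x p.1 == p.2) s].
Definition shiftc (s : cylinder) : cylinder := [seq (p.1 + 1, p.2) | p <- s].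
Definition left_shift (x : int -> bool) : int -> bool := fun i => x (i + 1).

Lemma cyl_shiftc s : cyl (shiftc s) = left_shift @^-1` cyl s.
Proof. by apply/seteqP; split=> x; rewrite /cyl /= all_map. Qed.

(** The masses [q s] that a measure on {0,1}^Z gives to the cylinders [cyl s].
    The last clause is shift invariance up to [eta]; the statistics of a
    finite set of length N satisfy it with [eta = 1 / N], and a law is the
    case [eta = 0]. *)
Record prelaw (eta : R) (q : cylinder -> R) : Prop := Prelaw {
  law_nil : q [::] = 1;
  law_ge0 : forall s, 0 <= q s;
  law_split : forall s i, q s = q ((i, true) :: s) + q ((i, false) :: s);
  law_eq : forall s s', cyl s = cyl s' -> q s = q s';
  law_diff : forall m : nat, (0 < m)%N -> ~ M m -> q [:: (0, true); (m%:Z, true)] = 0;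
  law_shift : forall s, `|q (shiftc s) - q s| <= eta }.

Definition law := prelaw 0.

Lemma law_le1 eta q s : prelaw eta q -> 0 <= q s <= 1.
Proof.
move=> lq; rewrite (law_ge0 lq)/=; elim: s => [|[i b] s IH]; first by rewrite (law_nil lq).
apply: le_trans IH; rewrite (law_split lq s i).
by case: b; rewrite ?lerDl ?lerDr (law_ge0 lq).
Qed.

Lemma eq_of_dist (x y : R) : (forall e, 0 < e -> `|x - y| <= e) -> x = y.
Proof.
move=> h; apply/eqP; rewrite -subr_eq0 -normr_le0; apply/ler_addgt0Pr => e e0.
by rewrite add0r h.
Qed.

(** Each clause involves finitely many cylinders, hence survives a limit. *)
Lemma prelaw_lim q : (forall eta, 0 < eta -> approximable (prelaw eta) q) -> law q.
Proof.
move=> hq; have hq1 := hq 1 ltr01.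
split.
- apply: eq_of_dist => e /(hq1 [:: [::]])[q' lq' /(_ [::])].
  by rewrite inE eqxx (law_nil lq') distrC; apply.
- move=> s; apply/ler_addgt0Pr => e /(hq1 [:: s])[q' lq' /(_ s)].
  by rewrite inE eqxx => /(_ isT); rewrite ler_norml; have := law_ge0 lq' s; lra.
- move=> s i; apply: eq_of_dist => e e0.
  have e3 : 0 < e / 3 by lra.
  have [q' lq' hq'] := hq1 [:: s; (i, true) :: s; (i, false) :: s] _ e3.
  have := hq' s; have := hq' ((i, true) :: s); have := hq' ((i, false) :: s).
  rewrite !inE !eqxx !orbT /= => /(_ isT) + /(_ isT) + /(_ isT).
  by have := law_split lq' s i; rewrite !ler_norml; lra.
- move=> s s' ss'; apply: eq_of_dist => e e0.
  have e3 : 0 < e / 3 by lra.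
  have [q' lq' hq'] := hq1 [:: s; s'] _ e3.
  have := hq' s; have := hq' s'.
  rewrite !inE !eqxx !orbT /= => /(_ isT) + /(_ isT).
  by have := law_eq lq' ss'; rewrite !ler_norml; lra.
- move=> m m0 nM; apply: eq_of_dist => e /(hq1 [:: [:: (0, true); (m%:Z, true)]])[q' lq'].
  move=> /(_ [:: (0, true); (m%:Z, true)]); rewrite inE eqxx => /(_ isT).
  by rewrite (law_diff lq' m0 nM) distrC.
- move=> s; rewrite (_ : q (shiftc s) = q s) ?subrr ?normr0//; apply: eq_of_dist => e e0.
  have e3 : 0 < e / 3 by lra.
  have [q' lq' hq'] := hq _ e3 [:: s; shiftc s] _ e3.
  have := hq' s; have := hq' (shiftc s).
  rewrite !inE !eqxx !orbT /= => /(_ isT) + /(_ isT).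
  by have := law_shift lq' s; rewrite !ler_norml; lra.
Qed.

Lemma law_closed q : approximable law q -> law q.
Proof.
move=> hq; apply: prelaw_lim => eta eta0; apply: approximableS hq => q' lq'.
split; [exact: law_nil lq'|exact: law_ge0 lq'|exact: law_split lq'|exact: law_eq lq'|
  exact: law_diff lq'|].
by move=> s; apply: le_trans (law_shift lq' s) (ltW eta0).
Qed.

Variable c : R.
Hypothesis HF : forall N, exists F : {set 'I_N}, c * N%:R <= #|F|%:R /\
  forall x y : 'I_N, x \in F -> y \in F -> (x < y)%N -> M (y - x)%N.

Section Empirical.
Variables (N : nat) (F : {set 'I_N}).
Hypothesis N0 : (0 < N)%N.
Hypothesis FM : forall x y : 'I_N, x \in F -> y \in F -> (x < y)%N -> M (y - x)%N.

Definition config (i : int) : bool :=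
  if i is Posz n then [exists x : 'I_N, (x \in F) && (x == n :> nat)] else false.

(** The frequency, among the N translates of the indicator of [F], of those
    lying in [cyl s]. *)
Definition empirical (s : cylinder) : R :=
  (\sum_(t < N) (all (fun p => config (t%:Z + p.1) == p.2) s)%:R) / N%:R.

Lemma empirical_prelaw : prelaw N%:R^-1 empirical.
Proof.
have NR : 0 < N%:R :> R by rewrite ltr0n.
split.
- by rewrite /empirical sumr_const card_ord divff ?gt_eqF.
- by move=> s; rewrite divr_ge0// sumr_ge0.
- move=> s i; rewrite /empirical -mulrDl -big_split /=; congr (_ / _); apply: eq_bigr => t _.
  by case: (config _); rewrite /= ?addr0 ?add0r.
- move=> s s' ss'; congr (_ / _); apply: eq_bigr => t _; congr (_%:R).
  have h s1 : all (fun p => config (t%:Z + p.1) == p.2) s1 = `[< cyl s1 (fun i => config (t%:Z + i)) >].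
    by apply/idP/asboolP.
  by rewrite !h ss'.
- move=> m m0 nM; rewrite /empirical big1 ?mul0r// => t _.
  case: (boolP (all _ _)) => //= /and3P[/eqP h1 /eqP h2 _].
  rewrite addn0 in h1.
  have [x /andP[xF /eqP xt]] := existsP h1.
  have [y /andP[yF /eqP ytm]] := existsP h2.
  exfalso; apply: nM; rewrite (_ : m = (y - x)%N); first by apply: FM => //; lia.
  lia.
- move=> s; rewrite -mulrBl normrM normfV [`|N%:R|]gtr0_norm// ler_pdivrMr// mulVf ?gt_eqF//.
  pose u (t : nat) : R := (all (fun p => config (t%:Z + p.1) == p.2) s)%:R.
  have -> : \sum_(t < N) (all (fun p => config (t%:Z + p.1) == p.2) (shiftc s))%:R =
     \sum_(t < N) u t.+1.
    apply: eq_bigr => t _; rewrite all_map /u; congr ((nat_of_bool _)%:R); apply: eq_all => p /=.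
    by congr (config _ == _); lia.
  rewrite -sumrB; have -> : \sum_(t < N) (u t.+1 - u t) = u N - u 0%N.
    by rewrite -(big_mkord xpredT (fun t => u t.+1 - u t)) telescope_sumr.
  rewrite /u; case: (all _ s); case: (all _ s); rewrite ?subrr ?subr0 ?sub0r ?normrN ?normr0 ?normr1//.
Qed.

Lemma empirical_one : empirical [:: (0, true)] = #|F|%:R / N%:R.
Proof.
congr (_ / _); rewrite -sum1_card natr_sum [RHS]big_mkcond /=; apply: eq_bigr => t _.
rewrite addn0 andbT.
suff -> : [exists x : 'I_N, (x \in F) && (x == t :> nat)] = (t \in F) by case: (t \in F).
apply/existsP/idP => [[x /andP[xF /eqP xt]]|tF]; last by exists t; rewrite tF eqxx.
by rewrite -(val_inj xt).
Qed.

End Empirical.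

Lemma exists_law : exists2 q, law q & c <= q [:: (0, true)].
Proof.
pose P n := [set q : cylinder -> R | prelaw n.+1%:R^-1 q /\ c <= q [:: (0, true)]].
have [|||q hq] := @cluster_family R cylinder (fun n => [set q | exists2 m, (n <= m)%N & P m q]).
- by move=> n q [m _ [lq _]] s; exact: law_le1 lq.
- move=> n; have [F [cF FM]] := HF n.+1; exists (empirical F), n => //; split.
    exact: empirical_prelaw.
  by rewrite empirical_one ler_pdivlMr.
- by move=> n q [m nm Pm]; exists m => //; exact: ltnW.
exists q.
  apply: prelaw_lim => eta eta0.
  have := hq (Num.truncn eta^-1); apply: approximableS => q' [m mn [lq' _]].
  split; [exact: law_nil lq'|exact: law_ge0 lq'|exact: law_split lq'|exact: law_eq lq'|
    exact: law_diff lq'|].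
  move=> s; apply: le_trans (law_shift lq' s) _.
  rewrite -[leRHS]invrK lef_pV2 ?posrE ?invr_gt0//.
  by apply: ltW (lt_le_trans (truncnS_gt _) _); rewrite ler_nat.
apply/ler_addgt0Pr => e e0; have [q' [m _ [_ cq']]] := hq 0%N [:: [:: (0, true)]] e e0.
by move=> /(_ [:: (0, true)]); rewrite inE eqxx => /(_ isT); rewrite ler_norml; lra.
Qed.

(** The order in which cylinder masses are maximised: x_0 = 1 comes first,
    which secures the mass [c]; every cylinder occurs later. *)
Definition lex_cylinder (n : nat) : cylinder :=
  if n is n'.+1 then odflt [::] (unpickle n') else [:: (0, true)].

Fixpoint lexmax (n : nat) : set (cylinder -> R) :=
  if n is n'.+1 then
    [set q | lexmax n' q /\ forall q', lexmax n' q' -> q' (lex_cylinder n') <= q (lex_cylinder n')]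
  else law.

Lemma lexmaxS n : lexmax n `<=` law.
Proof. by elim: n => [//|n IH] q [/IH]. Qed.

(** A linear functional attains its maximum on a compact set, and the
    maximisers form again a compact set. *)
Lemma lexmax_compact n : lexmax n !=set0 /\ forall q, approximable (lexmax n) q -> lexmax n q.
Proof.
elim: n => [|n [ne cl]].
  split; last exact: law_closed.
  by have [q lq _] := exists_law; exists q.
have bounds q : lexmax n q -> forall s, 0 <= q s <= 1.
  by move=> /lexmaxS lq s; exact: law_le1 lq.
pose V := [set q (lex_cylinder n) | q in lexmax n].
have supV : has_sup V.
  split; first by case: ne => q Lq; exists (q (lex_cylinder n)), q.
  by exists 1 => _ [q Lq <-]; case/andP: (bounds q Lq (lex_cylinder n)).
have Vub q : lexmax n q -> q (lex_cylinder n) <= sup V.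
  by move=> Lq; apply: ub_le_sup; [case: supV|exists q].
split.
  have [|||q hq] := @cluster_family R cylinder
      (fun j => [set q | lexmax n q /\ sup V - j.+1%:R^-1 < q (lex_cylinder n)]).
  - by move=> j q [Lq _]; exact: bounds.
  - move=> j; have j0 : 0 < j.+1%:R^-1 :> R by rewrite invr_gt0.
    by have [_ [q Lq <-] hq] := sup_adherent j0 supV; exists q.
  - move=> j q [Lq hq]; split=> //; apply: le_lt_trans hq; rewrite lerD2l lerN2.
    by rewrite lef_pV2 ?posrE// ler_nat.
  have Lq : lexmax n q.
    by apply: cl; apply: approximableS (hq 0%N) => q' [].
  exists q; split=> // q' Lq'; apply: le_trans (Vub q' Lq') _.
  apply/ler_addgt0Pr => e e0; have e2 : 0 < e / 2 by lra.
  pose j := Num.truncn (e / 2)^-1.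
  have je : j.+1%:R^-1 <= e / 2 by rewrite invf_ple ?posrE// ltW// truncnS_gt.
  have [q'' [_ hq''] /(_ (lex_cylinder n))] := hq j [:: lex_cylinder n] _ e2.
  rewrite inE eqxx => /(_ isT); move: (j.+1%:R^-1) je hq'' => w je hq''; rewrite ler_norml; lra.
move=> q hq; split; first by apply: cl; apply: approximableS hq => q' [].
move=> q' Lq'; apply/ler_addgt0Pr => e e0.
have [q'' [_ /(_ q' Lq') hq''] /(_ (lex_cylinder n))] := hq [:: lex_cylinder n] e e0.
by rewrite inE eqxx => /(_ isT); rewrite ler_norml; lra.
Qed.

(** A point of the intersection of all the faces [lexmax n]. If it is a proper
    convex combination of two laws, both lie in every face, since a face
    contains the ends of any segment whose interior it meets; so all three
    have the same masses on all cylinders. *)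
Lemma exists_extreme_law : exists q, [/\ law q, c <= q [:: (0, true)] &
  forall q1 q2 t, law q1 -> law q2 -> 0 < t < 1 ->
    (forall s, q s = t * q1 s + (1 - t) * q2 s) -> forall s, q1 s = q s].
Proof.
have [|||q hq] := @cluster_family R cylinder lexmax.
- by move=> n q /lexmaxS lq s; exact: law_le1 lq.
- by move=> n; case: (lexmax_compact n).
- by move=> n q [].
have Lq n : lexmax n q by case: (lexmax_compact n) => _; apply; exact: hq.
exists q; split; first exact: (Lq 0%N).
  have [q' lq' cq'] := exists_law; apply: le_trans cq' _.
  by have [_ /(_ q' lq')] := Lq 1%N.
move=> q1 q2 t l1 l2 /andP[t0 t1] qE.
have key n : lexmax n q1 /\ lexmax n q2.
  elim: n => [//|n [L1 L2]]; have [_ hmax] := Lq n.+1.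
  have h1 := hmax q1 L1; have h2 := hmax q2 L2; have hE := qE (lex_cylinder n).
  have e1 : q1 (lex_cylinder n) = q (lex_cylinder n) by nra.
  have e2 : q2 (lex_cylinder n) = q (lex_cylinder n) by nra.
  by split; split=> // q' Lq'; rewrite ?e1 ?e2; exact: hmax.
move=> s; have sE : lex_cylinder (pickle s).+1 = s by rewrite /lex_cylinder pickleK.
have max_at q' q'' : lexmax (pickle s).+2 q' -> lexmax (pickle s).+1 q'' -> q'' s <= q' s.
  by move=> [_ h] /h; rewrite sE.
by apply/le_anti/andP; split; apply: max_at => //; case: (key (pickle s).+1); case: (key (pickle s).+2).
Qed.

End Laws.

(** * Realisation of a law by a measure *)

(** A bijection from nat to int, in which order the coordinates are revealed.
    *)
Definition coordn (n : nat) : int := if odd n then Negz n./2 else Posz n./2.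
Definition natof (i : int) : nat := match i with Posz k => k.*2 | Negz k => k.*2.+1 end.

Lemma natofK i : coordn (natof i) = i.
Proof.
case: i => k; rewrite /coordn /natof.
  by rewrite odd_double doubleK.
by rewrite /= odd_double /= uphalf_double.
Qed.

Definition cylinder_sets : set (set (int -> bool)) := range cyl.
(* The sigma-algebra generated by the cylinders. *)
Notation shift_space := (g_sigma_algebraType cylinder_sets).

Lemma cylT : cyl [::] = setT.
Proof. by apply/seteqP; split. Qed.

Lemma cyl_cat s s' : cyl (s ++ s') = cyl s `&` cyl s'.
Proof.
by apply/seteqP; split=> x; rewrite /cyl /= all_cat => /andP.
Qed.

Lemma measurable_cyl s : measurable (cyl s : set shift_space).
Proof. by apply: sub_sigma_algebra; exists s. Qed.

Lemma cylinder_sets_setI : setI_closed cylinder_sets.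
Proof. by move=> _ _ [s _ <-] [s' _ <-]; exists (s ++ s') => //; rewrite cyl_cat. Qed.

Lemma shift_space_unique (R : realType) (m1 m2 : {measure set shift_space -> \bar R}) :
  (m1 setT < +oo)%E -> (forall s, m1 (cyl s) = m2 (cyl s)) ->
  forall A, measurable A -> m1 A = m2 A.
Proof.
move=> fin eqm A mA.
apply: (@measure_unique _ R shift_space cylinder_sets (fun=> setT) _ _ _ _ m1 m2) => //.
- exact: cylinder_sets_setI.
- by move=> _; exists [::] => //; rewrite cylT.
- by apply/seteqP; split=> // x _; exists 0%N.
- by move=> _ [s _ <-].
Qed.

Lemma measurable_to_shift_space d (T : measurableType d) (f : T -> shift_space) :
  (forall s, measurable (f @^-1` cyl s)) -> measurable_fun setT f.
Proof.
move=> h; apply: (@measurability _ _ T shift_space setT f cylinder_sets (erefl _)).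
by move=> _ [_ [s _ <-] <-]; rewrite setTI.
Qed.

Section Coding.
Variables (R : realType) (M : nat -> Prop) (q : cylinder -> R).
Hypothesis lq : law M q.

Lemma law_empty s : cyl s = set0 -> q s = 0.
Proof.
move=> s0; have := law_split lq s 0.
have e b : q ((0, b) :: s) = q s.
  apply: (law_eq lq); apply/seteqP; split=> x.
    by rewrite /cyl /= => /andP[].
  by rewrite s0.
rewrite !e; lra.
Qed.

Fixpoint wcyl (w : seq bool) : cylinder :=
  if w is b :: w' then (coordn (size w'), b) :: wcyl w' else [::].

(** The interval attached to a word [w], starting at [a], is cut here in two:
    the left part, for the bit [true], has the length of the mass of the
    longer word. *)
Definition cut (w : seq bool) (a : R) := a + q ((coordn (size w), true) :: wcyl w).

Fixpoint wleft (w : seq bool) : R :=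
  if w is b :: w' then (if b then wleft w' else cut w' (wleft w')) else 0.

Definition wright w := wleft w + q (wcyl w).

(** The bits read off from [r], the last one first. *)
Fixpoint word (r : R) (n : nat) : seq bool :=
  if n is n'.+1 then (r < cut (word r n') (wleft (word r n'))) :: word r n' else [::].

Definition code (r : R) : int -> bool :=
  fun i => r < cut (word r (natof i)) (wleft (word r (natof i))).

(** The words of length n label a partition of [0, 1) into intervals whose
    lengths are the masses of the corresponding cylinders. *)
Definition word_itv (w : seq bool) : set R := `[wleft w, wright w[.

Lemma size_word r n : size (word r n) = n.
Proof. by elim: n => //= n ->. Qed.

Lemma wright_false w : wright (false :: w) = wright w.
Proof. by rewrite /wright /= /cut (law_split lq (wcyl w) (coordn (size w))); lra. Qed.

Lemma wright_true w : wright (true :: w) = cut w (wleft w).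
Proof. by []. Qed.

Lemma wleft_cut w : wleft w <= cut w (wleft w) <= wright w.
Proof.
rewrite /cut lerDl (law_ge0 lq)/= /wright lerD2l (law_split lq (wcyl w) (coordn (size w))).
by rewrite lerDl (law_ge0 lq).
Qed.

Lemma word_itv_split w : word_itv w = word_itv (true :: w) `|` word_itv (false :: w).
Proof.
have /andP[h1 h2] := wleft_cut w.
apply/seteqP; split=> r; rewrite /word_itv /= wright_false wright_true !in_itv/=.
  move=> /andP[a b]; case: (ltP r (cut w (wleft w))) => h; [left|right].
    by rewrite a.
  by rewrite b.
by move=> [/andP[a b]|/andP[a b]]; apply/andP; split=> //;
  [exact: lt_le_trans h2|exact: le_trans a].
Qed.

Lemma word_itv_disj w : word_itv (true :: w) `&` word_itv (false :: w) = set0.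
Proof.
apply/seteqP; split=> // r; rewrite /word_itv /= !in_itv/= => -[/andP[_ a] /andP[b _]].
by move: a; rewrite wright_true ltNge b.
Qed.

Lemma word_itvP w r : word_itv w r -> word r (size w) = w.
Proof.
elim: w => //= b w IH h.
have hw : word_itv w r by rewrite word_itv_split; case: b h => h; [left|right].
rewrite (IH hw); congr (_ :: _).
move: h; rewrite /word_itv /= in_itv/=; case: b => /= /andP[h1 h2]; first by rewrite -wright_true h2.
by rewrite ltNge h1.
Qed.

Lemma nth_word r n m : (m < n)%N ->
  nth false (rev (word r n)) m = (r < cut (word r m) (wleft (word r m))).
Proof.
elim: n => // n IH; rewrite ltnS => mn /=; rewrite rev_cons nth_rcons size_rev size_word.
move: mn; rewrite leq_eqVlt => /orP[/eqP ->|mn]; first by rewrite ltnn eqxx.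
by rewrite mn IH.
Qed.

Definition word_point (w : seq bool) : int -> bool := fun i => nth false (rev w) (natof i).

Lemma cyl_wcyl w x : cyl (wcyl w) x -> forall i, (natof i < size w)%N -> x i = word_point w i.
Proof.
rewrite /cyl /word_point /=; elim: w => //= b w IH /andP[/eqP xb xw] i.
rewrite ltnS rev_cons nth_rcons size_rev leq_eqVlt => /orP[/eqP iw|iw].
  by rewrite iw ltnn eqxx -xb -iw natofK.
by rewrite iw IH.
Qed.

Lemma code_word_point w r i : word_itv w r -> (natof i < size w)%N -> code r i = word_point w i.
Proof.
by move=> hw iw; rewrite /code /word_point -(word_itvP hw) nth_word.
Qed.

Lemma eq_in_cyl x y s : (forall p, p \in s -> x p.1 = y p.1) -> cyl s x -> cyl s y.
Proof.
by move=> h /allP xs; apply/allP => p ps; rewrite -h// xs.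
Qed.

Definition coord_bound (s : cylinder) : nat := (\max_(p <- s) natof p.1).+1.

Lemma natof_bound s p : p \in s -> (natof p.1 < coord_bound s)%N.
Proof. by move=> ps; rewrite /coord_bound ltnS; apply: (@leq_bigmax_seq _ s xpredT (fun p => natof p.1)). Qed.

(** Descending induction on the length of [w]. Once [w] decides all
    coordinates occurring in [s], the set is the whole interval or empty; for
    shorter words both sides are additive under one further bit. *)
Lemma measure_code_word_itv s w :
  measurable (code @^-1` cyl s `&` word_itv w) /\
  lebesgue_measure (code @^-1` cyl s `&` word_itv w) = (q (wcyl w ++ s))%:E.
Proof.
have [k] := ubnP (coord_bound s - size w); elim: k w => // k IH w.
rewrite ltnS => hk; have [sw|sw] := leqP (coord_bound s) (size w).
  have small p : p \in s -> (natof p.1 < size w)%N.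
    by move=> /natof_bound/leq_trans; apply.
  have [ws|nws] := pselect (cyl s (word_point w)).
    have -> : code @^-1` cyl s `&` word_itv w = word_itv w.
      apply/setIidr => r Ir; apply: eq_in_cyl ws => p /small pw.
      by rewrite (code_word_point Ir).
    have -> : q (wcyl w ++ s) = q (wcyl w).
      apply: (law_eq lq); rewrite cyl_cat; apply/setIidl => x xw.
      by apply: eq_in_cyl ws => p /small pw; rewrite (cyl_wcyl xw).
    split; first exact: measurable_itv.
    rewrite /word_itv lebesgue_measure_itv/= lte_fin /wright ltrDl.
    have := law_ge0 lq (wcyl w); rewrite le_eqVlt => /orP[/eqP <-|->]; first by rewrite ltxx.
    by rewrite -EFinD addrAC subrr add0r.
  have -> : code @^-1` cyl s `&` word_itv w = set0.
    apply/seteqP; split=> // r [cr Ir]; apply: nws; apply: eq_in_cyl cr => p /small pw.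
    by rewrite (code_word_point Ir).
  have -> : q (wcyl w ++ s) = 0.
    apply: law_empty; rewrite cyl_cat; apply/seteqP; split=> // x [xw xs]; apply: nws.
    by apply: eq_in_cyl xs => p /small pw; rewrite (cyl_wcyl xw).
  by rewrite measure0.
have IHb b := IH (b :: w).
have [|m1 e1] := IHb true; first by rewrite /= -(ltn_predK sw); lia.
have [|m2 e2] := IHb false; first by rewrite /= -(ltn_predK sw); lia.
rewrite word_itv_split setIUr; split; first exact: measurableU.
have := (@measureU _ _ _ (@lebesgue_measure R) _ _ m1 m2).
move=> ->; last first.
  by rewrite setIACA word_itv_disj setI0.
apply: (eq_trans (f_equal2 (fun a b => a + b)%E e1 e2)).
by rewrite -EFinD (law_split lq (wcyl w ++ s) (coordn (size w))).
Qed.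

Lemma measurable_word n w : measurable ([set r | word r n = w] : set (measurableTypeR R)).
Proof.
elim: n w => [|n IH] w.
  have [->|w0] := eqVneq w [::]; first by rewrite (_ : [set _ | _] = setT)//; apply/seteqP; split.
  by rewrite (_ : [set _ | _] = set0)//; apply/seteqP; split=> // r /= e; move: w0; rewrite -e.
case: w => [|b w]; first by rewrite (_ : [set _ | _] = set0)//; apply/seteqP; split.
have -> : [set r | word r n.+1 = b :: w] =
   [set r | word r n = w] `&` (if b then `]-oo, cut w (wleft w)[%classic else `[cut w (wleft w), +oo[%classic).
  apply/seteqP; split=> r /=.
    by move=> [<- <-]; split=> //; case: ltP => h; rewrite /= in_itv/= ?andbT.
  move=> [<-] h; congr (_ :: _); case: b h; rewrite /= in_itv/= ?andbT// => h.
  by apply/negbTE; rewrite -leNgt.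
by apply: measurableI => //; case: b; exact: measurable_itv.
Qed.

Lemma measurable_code : measurable_fun setT (code : measurableTypeR R -> shift_space).
Proof.
apply: measurable_to_shift_space => s; elim: s => [|[i b] s IH].
  by rewrite cylT preimage_setT.
have -> : code @^-1` cyl ((i, b) :: s) =
   [set r | code r i = b] `&` code @^-1` cyl s.
  apply/seteqP; split=> r; rewrite /cyl /=; first by move=> /andP[/eqP].
  by move=> [-> ->]; rewrite eqxx.
apply: measurableI => //.
have -> : [set r | code r i = b] =
   \bigcup_(w in [set w | head true w = b]) [set r | word r (natof i).+1 = w].
  apply/seteqP; split=> r /=; first by move=> e; exists (word r (natof i).+1).
  by move=> [w /= <- <-].
rewrite bigcup_mkcond; apply: countable_bigcupT_measurable.
  exact: countableP.
move=> w; case: ifP => // _; exact: measurable_word.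
Qed.

HB.instance Definition _ := @isMeasurableFun.Build _ _ _ _ (code : measurableTypeR R -> shift_space) measurable_code.

Definition law_measure : probability shift_space R :=
  distribution (uniform_prob (@ltr01 R)) (code : {mfun measurableTypeR R >-> shift_space}).

Lemma uniform_prob01E (A : set R) : measurable A ->
  uniform_prob (@ltr01 R) A = lebesgue_measure (A `&` `[0, 1[).
Proof.
move=> mA; rewrite /uniform_prob integral_uniform_pdf.
have mA1 : measurable (A `&` `[0, 1]) by apply: measurableI.
rewrite (eq_integral (cst 1%E)); last first.
  move=> x; rewrite inE /= => -[_]; rewrite in_itv/= /uniform_pdf => ->.
  by rewrite subr0 invr1.
rewrite integral_cst// mul1e.
have -> : A `&` `[0, 1] = (A `&` `[0, 1[) `|` (A `&` [set 1]).
  rewrite -setIUr; congr (_ `&` _); apply/seteqP; split=> x /=; rewrite !in_itv/=.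
    by move=> /andP[-> ]; rewrite le_eqVlt => /orP[/eqP|] ->; [right|left].
  by move=> [/andP[-> /ltW]//|->]; rewrite lexx ler01.
have mA2 : measurable (A `&` [set (1 : R)]) by apply: measurableI.
rewrite measureU//=; last 2 first.
- by apply: measurableI.
- apply/seteqP; split=> // x [[_]]; rewrite /= in_itv/= => /andP[_ x1] [_ xe].
  by rewrite xe ltxx in x1.
rewrite [X in (_ + X)%E](_ : _ = 0%E) ?adde0//.
apply/eqP; rewrite eq_le measure_ge0 andbT -(lebesgue_measure_set1 (1 : R)).
by apply: le_measure; rewrite ?inE.
Qed.

(** Any law is the family of cylinder masses of an actual measure. *)
Lemma law_measure_cyl s : law_measure (cyl s) = (q s)%:E.
Proof.
rewrite /law_measure /distribution /= /pushforward uniform_prob01E; last first.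
  by rewrite -[X in measurable X]setTI; apply: measurable_code => //; exact: measurable_cyl.
have [_] := measure_code_word_itv s [::].
by rewrite /word_itv /wright /= (law_nil lq) add0r.
Qed.

End Coding.

(** * Frequencies of visits in an ergodic system *)

Section ErgodicTheorem.
Variables (R : realType) (d : measure_display) (X : measurableType d).
Variables (mu : probability X R) (T : X -> X).
Hypothesis mp : measure_preserving mu T.

Let mT : measurable_fun setT T := mp.1.

Definition visits (B : set X) (x : X) (n : nat) : R := \sum_(j < n) \1_B (iter j T x).

Lemma visitsS B x n : visits B x n.+1 = \1_B x + visits B (T x) n.
Proof.
rewrite /visits big_ord_recl /=; congr (_ + _).
by apply: eq_bigr => i _; rewrite -iterSr.
Qed.

Lemma visits_add B x j n : visits B x (j + n) = visits B x j + visits B (iter j T x) n.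
Proof.
elim: j x => [|j IH] x; first by rewrite add0n {2}/visits big_ord0 add0r.
by rewrite addSn !visitsS IH addrA -iterSr.
Qed.

Lemma visits_ge0 B x n : 0 <= visits B x n.
Proof. by apply: sumr_ge0 => i _; rewrite indicE. Qed.

Lemma visitsC B x n : visits (~` B) x n = n%:R - visits B x n.
Proof.
rewrite -[n%:R]/(n%:R) -{2}(card_ord n) -sumr_const /visits -sumrB; apply: eq_bigr => i _.
by rewrite !indicE in_setC; case: (_ \in _); rewrite /= ?subrr ?subr0.
Qed.

Lemma measurable_iter n : measurable_fun setT (iter n T).
Proof.
elim: n => [|n IH]; first exact: measurable_id.
exact: (measurableT_comp mT IH).
Qed.

Lemma integral_comp_T (f : X -> \bar R) : measurable_fun setT f -> (forall x, (0 <= f x)%E) ->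
  (\int[mu]_x f (T x) = \int[mu]_x f x)%E.
Proof.
move=> mf f0.
have := ge0_integral_pushforward mT mu measurableT mf.
rewrite preimage_setT => H; rewrite -H; last by move=> y _; exact: f0.
apply: eq_measure_integral => A mA _; exact: mp.2.
Qed.

Section Maximal.
Variables (B : set X) (a : R).
Hypothesis mB : measurable B.
Hypothesis a0 : 0 <= a.

(** The maximum over k <= n of k a - (number of visits among the first k
    steps), which is nonnegative because of k = 0. *)
Fixpoint deficit (n : nat) (x : X) : R :=
  if n is n'.+1 then Num.max 0 (a - \1_B x + deficit n' (T x)) else 0.

Lemma deficit_ge0 n x : 0 <= deficit n x.
Proof. by case: n => //= n; rewrite le_max lexx. Qed.

Lemma deficit_mono n x : deficit n x <= deficit n.+1 x.
Proof.
elim: n x => [|n IH] x; first exact: deficit_ge0.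
change (Num.max 0 (a - \1_B x + deficit n (T x)) <=
  Num.max 0 (a - \1_B x + deficit n.+1 (T x))).
by rewrite ge_max !le_max lexx/= lerD2l IH orbT.
Qed.

Lemma deficit_le n x : deficit n x <= n%:R * a.
Proof.
elim: n x => [|n IH] x; first by rewrite mul0r.
rewrite /= ge_max mulr_ge0//= -natr1 mulrDl mul1r addrC lerD//.
by rewrite lerBlDr lerDl indicE.
Qed.

Lemma deficit_visits n x : n%:R * a - visits B x n <= deficit n x.
Proof.
elim: n x => [|n IH] x; first by rewrite mul0r /visits big_ord0 subrr.
rewrite /= le_max; apply/orP; right; rewrite visitsS.
by have := IH (T x); rewrite -natr1 mulrDl mul1r; lra.
Qed.

Lemma measurable_deficit n : measurable_fun setT (deficit n).
Proof.
elim: n => [|n IH] /=; first exact: measurable_cst.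
apply: measurable_maxr; first exact: measurable_cst.
apply: measurable_funD; last exact: (measurableT_comp IH mT).
apply: measurable_funB; first exact: measurable_cst.
exact: measurable_indic.
Qed.

Definition nodef (n : nat) : set X := [set x | deficit n x = 0].

Lemma measurable_nodef n : measurable (nodef n).
Proof.
rewrite (_ : nodef n = setT `&` deficit n @^-1` [set 0]); last by rewrite setTI.
by apply: (measurable_deficit n).
Qed.

(** Garsia's inequality. Where the deficit is positive it equals a - 1_B plus
    the deficit of one step less at T x; elsewhere the term 1 on [nodef]
    compensates since 1_B - a <= 1. *)
Lemma deficit_cocycle n x :
  deficit n x + \1_B x <= a + \1_(nodef n) x + deficit n (T x).
Proof.
have B1 : \1_B x <= 1 :> R by rewrite indicE; case: (_ \in _).
have d0 := deficit_ge0 n (T x).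
rewrite [\1_(nodef n) x]indicE; case: (boolP (x \in nodef n)) => h.
  by rewrite inE in h; rewrite (_ : deficit n x = 0)//=; have := a0; lra.
have {h} : deficit n x != 0 by apply: contra h => /eqP h; rewrite inE.
case: n d0 => [|n] d0; first by rewrite eqxx.
have := deficit_mono n (T x).
change (deficit n.+1 x) with (Num.max 0 (a - \1_B x + deficit n (T x))).
by case: (leP 0 (a - \1_B x + deficit n (T x))); rewrite ?eqxx// => _ + _;
  rewrite [false%:R]mulr0n; lra.
Qed.

(** Integrate [deficit_cocycle]: the two integrals of the deficit are equal,
    as T preserves the measure, and finite, so they cancel. *)
Lemma measure_nodef n : ((fine (mu B) - a)%:E <= mu (nodef n))%E.
Proof.
have muB : mu B = (fine (mu B))%:E by rewrite fineK// fin_num_measure.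
have mD := measurable_deficit n.
have mN := measurable_nodef n.
have mDT : measurable_fun setT (fun x => deficit n (T x)) by exact: measurableT_comp mD mT.
pose I := (\int[mu]_x (deficit n x)%:E)%E.
have I0 : (0 <= I)%E by apply: integral_ge0 => x _; rewrite lee_fin deficit_ge0.
have Ifin : I \is a fin_num.
  rewrite ge0_fin_numE//; apply: (@le_lt_trans _ _ (\int[mu]_x (n%:R * a)%:E)%E).
    apply: ge0_le_integral => //.
    - by move=> x _; rewrite lee_fin deficit_ge0.
    - exact/measurable_EFinP.
    - by move=> x _; rewrite lee_fin deficit_le.
  by rewrite integral_cst//= probability_setT mule1 ltry.
have L : (\int[mu]_x (deficit n x + \1_B x)%:E = I + mu B)%E.
  rewrite (eq_integral (fun x => (deficit n x)%:E + (\1_B x)%:E)%E); last by move=> x _; rewrite EFinD.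
  rewrite ge0_integralD//=.
  - by rewrite integral_indic// setIT.
  - by move=> x _; rewrite lee_fin deficit_ge0.
  - exact/measurable_EFinP.
  - by apply/measurable_EFinP; exact: measurable_indic.
have Rr : (\int[mu]_x (a + \1_(nodef n) x + deficit n (T x))%:E = a%:E + mu (nodef n) + I)%E.
  rewrite (eq_integral (fun x => (a%:E + (\1_(nodef n) x)%:E) + (deficit n (T x))%:E)%E); last first.
    by move=> x _; rewrite !EFinD.
  have mi : measurable_fun setT (fun x => (\1_(nodef n) x)%:E : \bar R).
    by apply/measurable_EFinP; exact: measurable_indic.
  rewrite ge0_integralD//=.
  - rewrite ge0_integralD//=.
    rewrite integral_cst//= probability_setT mule1 integral_indic// setIT.
      congr (_ + _)%E; apply: (@integral_comp_T (fun x => (deficit n x)%:E)) => //.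
        exact/measurable_EFinP.
      by move=> x; rewrite lee_fin deficit_ge0.
  - by move=> x _; rewrite adde_ge0// lee_fin indicE.
  - by apply: emeasurable_funD.
  - by move=> x _; rewrite lee_fin deficit_ge0.
  - exact/measurable_EFinP.
have : (I + mu B <= a%:E + mu (nodef n) + I)%E.
  rewrite -L -Rr; apply: ge0_le_integral => //.
  - by move=> x _; rewrite lee_fin addr_ge0 ?deficit_ge0// indicE.
  - by apply/measurable_EFinP; apply: measurable_funD => //; exact: measurable_indic.
  - apply/measurable_EFinP; apply: measurable_funD => //; apply: measurable_funD => //.
  - by move=> x _; rewrite lee_fin deficit_cocycle.
rewrite addeC leeD2rE// muB -leeBlDl// EFinB.
Qed.

Definition above : set X := [set x | forall n, n%:R * a <= visits B x n].

Lemma measure_above : a < fine (mu B) -> exists2 A, measurable A & (0 < mu A)%E /\ A `<=` above.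
Proof.
move=> aB; exists (\bigcap_n nodef n).
  by apply: bigcap_measurable => // k _; exact: measurable_nodef.
split; last first.
  by move=> x hx n; have := deficit_visits n x; rewrite (hx n I) subr_le0.
have mc : measurable (\bigcap_n nodef n).
  by apply: bigcap_measurable => // k _; exact: measurable_nodef.
apply: (@lt_le_trans _ _ (fine (mu B) - a)%:E); first by rewrite lte_fin subr_gt0.
have cv : mu \o nodef @ \oo --> mu (\bigcap_n nodef n).
  apply: nonincreasing_cvg_mu => //.
  - by rewrite (le_lt_trans (probability_le1 _ (measurable_nodef 0)))// ltry.
  - exact: measurable_nodef.
  - apply/nonincreasing_seqP => n; apply/subsetPset => x; rewrite /nodef /= => h.
    by apply/le_anti; rewrite deficit_ge0 andbT -h deficit_mono.
rewrite -(cvg_lim _ cv)//; apply: lime_ge; first by apply/cvg_ex; eexists; exact: cv.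
by apply: nearW => n; exact: measure_nodef.
Qed.

End Maximal.

Hypothesis erg : ergodic mu T.

(** The set of points that ever visit A contains its preimage, which has the
    same measure; so it is invariant, and not null. *)
Lemma ergodic_hits A : measurable A -> (0 < mu A)%E -> {ae mu, forall x, exists j, A (iter j T x)}.
Proof.
move=> mA A0; pose U := \bigcup_j (iter j T @^-1` A).
have mU : measurable U.
  apply: bigcupT_measurable => j; rewrite -[X in measurable X]setTI.
  by apply: measurable_iter.
have mTU : measurable (T @^-1` U) by rewrite -[X in measurable X]setTI; exact: mT.
have TU : T @^-1` U `<=` U by move=> x [j _ h]; exists j.+1 => //; rewrite /= -iterSr in h *.
have muTU := mp.2 U mU.
have null : mu (U `\` T @^-1` U) = 0%E.
  rewrite measureD//; last by rewrite (le_lt_trans (probability_le1 _ mU))// ltry.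
  have UT : U `&` T @^-1` U = T @^-1` U by apply/setIidr.
  rewrite UT -[RHS](subee (x := mu U)) ?fin_num_measure//; congr (_ - _)%E; exact: muTU.
have [|U0|U1] := erg mU.
- exists (U `\` T @^-1` U); split; [exact: measurableD|exact: null|].
  move=> x /= h; split.
    apply: contrapT => nU; apply: h; rewrite !indicE !memNset//.
    by move=> /TU.
  by move=> hT; apply: h; rewrite !indicE !mem_set//; exact: TU.
- have : (mu A <= mu U)%E.
    by apply: le_measure; rewrite ?inE// => x Ax; exists 0%N.
  by rewrite U0 leNgt A0.
- exists (~` U); split; first exact: measurableC.
    by rewrite probability_setC// U1 subee.
  by move=> x /= h; apply: contra_not h => -[j _ hj]; exists j.
Qed.

(** Almost every orbit enters a set of points all of whose visit counts are at
    least n a, and the finitely many steps before cost a constant. *)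
Lemma visits_liminf B k : measurable B ->
  {ae mu, forall x, exists j : nat, forall n, n%:R * (fine (mu B) - k.+1%:R^-1) - j%:R <= visits B x n}.
Proof.
move=> mB; set a := _ - _.
have k0 : 0 < k.+1%:R^-1 :> R by rewrite invr_gt0.
have [a0|a0] := leP 0 a; last first.
  apply: aeW => x; exists 0%N => n; rewrite subr0; apply: le_trans (visits_ge0 _ _ _).
  by rewrite mulr_ge0_le0// ltW.
have aB : a < fine (mu B) by rewrite /a ltrBlDr ltrDl.
have muB1 : fine (mu B) <= 1.
  by rewrite -lee_fin fineK ?fin_num_measure// probability_le1.
have [A mA [A0 Aab]] := measure_above mB a0 aB.
have := ergodic_hits mA A0; apply: filterS => x [j /Aab hj].
exists j => n; have [nj|jn] := leqP j n.
  have := hj (n - j)%N; have := visits_add B x j (n - j); rewrite subnKC// => ->.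
  have := visits_ge0 B x j; rewrite natrB// mulrBl.
  have : j%:R * a <= j%:R * 1 by rewrite ler_wpM2l//; lra.
  lra.
apply: le_trans (visits_ge0 _ _ _); rewrite subr_le0.
apply: le_trans (_ : n%:R * 1 <= _); first by rewrite ler_wpM2l//; lra.
by rewrite mulr1 ler_nat ltnW.
Qed.

(** The lower bound of [visits_liminf] for B and for its complement. *)
Lemma birkhoff_indicator B : measurable B ->
  {ae mu, forall x, visits B x n / n%:R @[n --> \oo] --> fine (mu B)}.
Proof.
move=> mB; have mCB := measurableC mB.
have h1 : {ae mu, forall x, forall k, exists j : nat, forall n,
    n%:R * (fine (mu B) - k.+1%:R^-1) - j%:R <= visits B x n}.
  by apply/ae_foralln => k; exact: visits_liminf.
have h2 : {ae mu, forall x, forall k, exists j : nat, forall n,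
    n%:R * (fine (mu (~` B)) - k.+1%:R^-1) - j%:R <= visits (~` B) x n}.
  by apply/ae_foralln => k; exact: visits_liminf.
move: h1 h2; apply: filterS2 => x h1 h2.
have muC : fine (mu (~` B)) = 1 - fine (mu B).
  by rewrite probability_setC// fineB ?fin_num_measure.
apply/cvgrPdist_le => e e0.
pose k := Num.truncn (2 / e).
have ke : k.+1%:R^-1 <= e / 2.
  by rewrite invf_ple ?posrE ?divr_gt0// invf_div ltW// truncnS_gt.
have [j1 hj1] := h1 k; have [j2 hj2] := h2 k.
pose j := maxn j1 j2.
exists (Num.truncn (2 * j%:R / e)).+1 => // n /= hn.
have n0 : 0 < n%:R :> R by rewrite ltr0n (leq_trans _ hn).
have hn' : j%:R <= n%:R * (e / 2).
  have : 2 * j%:R / e <= n%:R by apply: ltW (lt_le_trans (truncnS_gt _) _); rewrite ler_nat.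
  by rewrite ler_pdivrMr//; lra.
have j1j : j1%:R <= j%:R :> R by rewrite ler_nat leq_maxl.
have j2j : j2%:R <= j%:R :> R by rewrite ler_nat leq_maxr.
have nk : n%:R * k.+1%:R^-1 <= n%:R * (e / 2) by rewrite ler_wpM2l// ltW.
have l1 := hj1 n; have l2 := hj2 n; rewrite muC visitsC in l2.
rewrite -[X in `|X|](@mulfK _ n%:R) ?gt_eqF// normrM normfV [`|n%:R|]gtr0_norm//.
rewrite ler_pdivrMr// mulrBl divfK ?gt_eqF// ler_norml.
move: (k.+1%:R^-1) l1 l2 nk => w l1 l2 nk.
apply/andP; split; lra.
Qed.

End ErgodicTheorem.

(** * Ergodicity of extreme laws and the set of return times *)

Lemma ae_le_measure (R : realType) d (X : measurableType d) (mu : {measure set X -> \bar R})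
  (A B : set X) : measurable A -> measurable B -> {ae mu, forall x, A x -> B x} ->
  (mu A <= mu B)%E.
Proof.
move=> mA mB [N [mN N0 hN]]; have {}N0 : mu N = 0%E := N0.
apply: (@le_trans _ _ (mu (B `|` N))).
  apply: le_measure; rewrite ?inE//; first exact: measurableU.
  move=> x Ax; have [Bx|nBx] := pselect (B x); first by left.
  by right; apply: hN => /= h; apply: nBx; exact: h.
by apply: le_trans (measureU2 _ mB mN) _; rewrite [X in (_ + X)%E]N0 adde0.
Qed.

Lemma measurable_left_shift : measurable_fun setT (left_shift : shift_space -> shift_space).
Proof.
by apply: measurable_to_shift_space => s; rewrite -cyl_shiftc; exact: measurable_cyl.
Qed.

Lemma left_shift_invertible : invertible (left_shift : shift_space -> shift_space).
Proof.
exists (fun x i => x (i - 1)); split.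
- apply: measurable_to_shift_space => s.
  rewrite (_ : _ @^-1` _ = cyl [seq (p.1 - 1, p.2) | p <- s]); first exact: measurable_cyl.
  by apply/seteqP; split=> x; rewrite /cyl /= all_map.
- by move=> x; apply/funext => i; rewrite /left_shift subrK.
- by move=> x; apply/funext => i; rewrite /left_shift addrK.
Qed.

HB.instance Definition _ := @isMeasurableFun.Build _ _ _ _ (left_shift : shift_space -> shift_space)
  measurable_left_shift.

Section ExtremeLaw.
Variables (R : realType) (M : nat -> Prop) (q : cylinder -> R).
Hypothesis lq : law M q.

Let mu := law_measure q.

Lemma law_shiftE s : q (shiftc s) = q s.
Proof. by have := law_shift lq s; rewrite normr_le0 subr_eq0 => /eqP. Qed.

Lemma law_measure_shift : measure_preserving mu (left_shift : shift_space -> shift_space).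
Proof.
split; first exact: measurable_left_shift.
move=> A mA.
apply: (shift_space_unique (m1 := distribution mu (left_shift : {mfun shift_space >-> shift_space}))
  (m2 := mu)) mA.
  by rewrite /distribution /pushforward /= preimage_setT probability_setT ltry.
move=> s; change (mu (left_shift @^-1` cyl s) = mu (cyl s)); rewrite -cyl_shiftc.
by rewrite /mu !(law_measure_cyl lq) law_shiftE.
Qed.

(** Conditioning on an invariant event gives again an invariant measure. *)
Lemma conditional_law (E : set shift_space) : measurable E ->
  {ae mu, forall x, \1_E x = \1_(left_shift @^-1` E) x :> R} -> 0 < fine (mu E) ->
  law M (fun s => fine (mu (cyl s `&` E)) / fine (mu E)).
Proof.
move=> mE invE p0; set p := fine (mu E) in p0 *.
have mI s : measurable (cyl s `&` E : set shift_space).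
  by apply: measurableI => //; exact: measurable_cyl.
have fin A : measurable A -> mu A \is a fin_num by move=> mA; exact: fin_num_measure.
split.
- by rewrite cylT setTI divff// gt_eqF.
- by move=> s; rewrite divr_ge0 ?fine_ge0// ltW.
- move=> s i; rewrite -mulrDl -fineD ?fin//; congr (fine _ / _).
  rewrite -measureU//; last first.
    apply/seteqP; split=> // x [[+ _] [+ _]]; rewrite /cyl /= => /andP[/eqP -> _].
    by [].
  congr (mu _); rewrite -setIUl; congr (_ `&` _); apply/seteqP; split=> x; rewrite /cyl /=.
    by move=> ->; case: (x i); [left|right].
  by case=> /andP[].
- by move=> s s' ->.
- move=> m m0 nM; rewrite (_ : fine _ = 0) ?mul0r//.
  apply/eqP; rewrite -eqe fineK ?fin//; apply/eqP/le_anti; rewrite measure_ge0 andbT.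
  have : mu (cyl [:: (0, true); (m%:Z, true)]) = 0%E by rewrite /mu (law_measure_cyl lq) (law_diff lq).
  move=> cz; rewrite -[leRHS]cz; apply: le_measure; rewrite ?inE//; exact: measurable_cyl.
- move=> s; rewrite -mulrBl (_ : fine _ - fine _ = 0) ?mul0r ?normr0//.
  apply/eqP; rewrite subr_eq0; apply/eqP; congr fine.
  have mpre (A : set shift_space) : measurable A -> measurable (left_shift @^-1` A : set shift_space).
    by move=> mA; rewrite -[X in measurable X]setTI; exact: measurable_left_shift.
  rewrite -(law_measure_shift.2 _ (mI s)) cyl_shiftc preimage_setI.
  have mC := mpre _ (measurable_cyl s); have mS := mpre _ mE.
  apply/le_anti/andP; split; apply: ae_le_measure; try exact: measurableI.
    move: invE; apply: filterS => x + [? Ex].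
    by rewrite !indicE (mem_set Ex) /=; case: (boolP (x \in _)) => [/set_mem//|_ /eqP]; rewrite oner_eq0.
  move: invE; apply: filterS => x + [? Ex]; rewrite !indicE (mem_set Ex) /=.
  by case: (boolP (x \in E)) => [/set_mem//|_ /eqP]; rewrite eq_sym oner_eq0.
Qed.

Hypothesis extreme : forall q1 q2 t, law M q1 -> law M q2 -> 0 < t < 1 ->
    (forall s, q s = t * q1 s + (1 - t) * q2 s) -> forall s, q1 s = q s.

(** If E is invariant and 0 < mu E < 1, then mu is a combination of its
    conditional measures on E and on the complement. By extremality mu is
    equal to the first, so E is independent of itself and mu E = (mu E)^2. *)
Lemma law_measure_ergodic : ergodic mu (left_shift : shift_space -> shift_space).
Proof.
move=> E mE invE; set p := fine (mu E).
have fin A : measurable A -> mu A \is a fin_num by move=> mA; exact: fin_num_measure.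
have muE : mu E = p%:E by rewrite fineK// fin.
have p0 : 0 <= p by rewrite fine_ge0.
have p1 : p <= 1 by rewrite -lee_fin -muE probability_le1.
have mC := measurableC mE.
have muC : fine (mu (~` E)) = 1 - p by rewrite probability_setC// fineB ?fin.
have [pE|np0] := eqVneq p 0; first by left; rewrite muE pE.
have [pE|np1] := eqVneq p 1; first by right; rewrite muE pE.
have p01 : 0 < p < 1 by rewrite !lt_neqAle p0 p1 eq_sym np0 np1.
have invC : {ae mu, forall x, \1_(~` E) x = \1_(left_shift @^-1` (~` E)) x :> R}.
  move: invE; apply: filterS => x; rewrite preimage_setC !indicE !in_setC.
  by case: (_ \in _); case: (_ \in _) => //= /eqP; rewrite ?oner_eq0 1?eq_sym ?oner_eq0.
have l1 := conditional_law mE invE (proj1 (andP p01)).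
have l2 : law M (fun s => fine (mu (cyl s `&` ~` E)) / (1 - p)).
  by rewrite -muC; apply: conditional_law => //; rewrite muC subr_gt0; case/andP: p01.
have mI s : measurable (cyl s `&` E : set shift_space).
  by apply: measurableI => //; exact: measurable_cyl.
have key s : fine (mu (cyl s `&` E)) / p = q s.
  apply: (extreme l1 l2 p01) => s'.
  rewrite !(mulrC _ (_ / _)) !divfK//; last by rewrite subr_eq0 eq_sym.
  have mI' : measurable (cyl s' `&` ~` E : set shift_space).
    by apply: measurableI => //; exact: measurable_cyl.
  rewrite -fineD ?fin// -measureU//; last by rewrite setIACA setICr setI0.
  rewrite -setIUr setUCr setIT.
  by change (q s' = fine (law_measure q (cyl s'))); rewrite (law_measure_cyl lq).
have [pn pnE] : exists pn : {nonneg R}, pn%:num = p by exists (NngNum p0).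
have : mrestr mu mE E = mscale pn mu E.
  apply: (@shift_space_unique R (mrestr mu mE) (mscale pn mu)) => //.
    by rewrite /= /mrestr setTI muE ltry.
  move=> s; change (mu (cyl s `&` E) = pn%:num%:E * mu (cyl s))%E.
  rewrite pnE -[LHS](fineK (fin _ (mI s))) -[fine _](@divfK _ p)// key mulrC EFinM.
  by congr (_ * _)%E; rewrite /mu (law_measure_cyl lq).
change (mu (E `&` E) = pn%:num%:E * mu E -> mu E = 0 \/ mu E = 1)%E.
rewrite setIid muE pnE -EFinM => -[pp].
by exfalso; move: np1; rewrite -(inj_eq (mulfI np0)) mulr1 -pp eqxx.
Qed.

End ExtremeLaw.

Lemma indic_Lfun (R : realType) d (X : measurableType d) (mu : probability X R) (A : set X) :
  measurable A -> (\1_A : X -> R) \in Lfun mu 2%:E.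
Proof.
move=> mA; rewrite inE; apply/andP; split; rewrite inE /=.
  exact: measurable_indic.
rewrite /finite_norm unlock /=; apply: poweR_lty.
rewrite (eq_integral (fun x => (\1_A x)%:E)); last first.
  move=> x _; rewrite indicE; case: (_ \in _) => /=; first by rewrite normr1 powR1.
  by rewrite normr0 powR0.
rewrite integral_indic// setIT.
by rewrite (le_lt_trans (probability_le1 _ mA))// ltry.
Qed.

Lemma iter_shift n (x : int -> bool) i : iter n left_shift x i = x (i + n%:Z).
Proof.
elim: n x i => [|n IH] x i; first by rewrite addr0.
by rewrite iterSr IH /left_shift; congr x; lia.
Qed.

Section ReturnSet.
Variables (R : realType) (M : nat -> Prop) (c : R) (a : nat -> nat).
Hypothesis a_erg : pointwise_ergodic R a.
Hypothesis c0 : 0 < c.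
Hypothesis HF : forall N, exists F : {set 'I_N}, c * N%:R <= #|F|%:R /\
  forall x y : 'I_N, x \in F -> y \in F -> (x < y)%N -> M (y - x)%N.

Lemma exists_return_set : exists S : set nat,
  [/\ S `<=` posN, exists x : R, has_density S x /\ c <= x,
    forall s m, S s -> S (s + m)%N -> (0 < m)%N -> M m &
    c <= upper_density R [set n | (0 < n)%N /\ S `&` shift_down S (a n) !=set0]].
Proof.
have [q [lq cq ext]] := exists_extreme_law HF.
pose mu := law_measure q.
pose A : set shift_space := cyl [:: (0, true)].
have mA : measurable A by exact: measurable_cyl.
have muA : mu A = (q [:: (0, true)])%:E by rewrite /mu (law_measure_cyl lq).
set al := q [:: (0, true)] in cq muA.
have erg := law_measure_ergodic lq ext.
have ae1 := birkhoff_indicator (law_measure_shift lq) erg mA.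
have ae2 := a_erg (law_measure_shift lq) left_shift_invertible erg (indic_Lfun mu mA).
(* Invariance moves the null cylinders x_0 = x_m = 1 to every position. *)
have shifted s m : q [:: (s%:Z, true); ((s + m)%N%:Z, true)] = q [:: (0, true); (m%:Z, true)].
  elim: s => [//|s IH]; rewrite -IH -[RHS](law_shiftE lq); congr q => /=.
  by congr [:: (_, _); (_, _)]; lia.
have ae3 : {ae mu, forall x : shift_space, forall m s, (0 < m)%N -> ~ M m ->
    ~ (x s%:Z = true /\ x (s + m)%N%:Z = true)}.
  apply/ae_foralln => m; apply/ae_foralln => s.
  have [[m0 nM]|h] := pselect ((0 < m)%N /\ ~ M m); last first.
    by apply: aeW => x m0 nM; exfalso; apply: h.
  exists (cyl [:: (s%:Z, true); ((s + m)%N%:Z, true)]); split.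
  - exact: measurable_cyl.
  - by change (law_measure q (cyl [:: (s%:Z, true); ((s + m)%N%:Z, true)]) = 0%E);
      rewrite (law_measure_cyl lq) shifted (law_diff lq).
  - move=> x /= h; apply: contrapT => nx; apply: h => _ _ [xs xsm]; apply: nx.
    by rewrite /cyl /= xs xsm.
have [x [xA [x1 [x2 x3]]]] : exists x : shift_space, A x /\ (@visits R _ shift_space left_shift A x n / n%:R @[n --> \oo] --> fine (mu A) /\
   ((N%:R^-1 * \sum_(1 <= n < N.+1) \1_A (iter (a n) left_shift x)) @[N --> \oo] --> \int[mu]_y \1_A y) /\
   (forall m s, (0 < m)%N -> ~ M m -> ~ (x s%:Z = true /\ x (s + m)%N%:Z = true))).
  apply: contrapT => nex.
  have : {ae mu, forall x, ~ A x}.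
    by apply: filterS3 ae1 ae2 ae3 => x h1 h2 h3 Ax; apply: nex; exists x.
  move=> ae4; have : (mu A <= mu set0)%E := @ae_le_measure R _ _ mu A set0 mA measurable0 ae4.
  by rewrite measure0 muA lee_fin leNgt (lt_le_trans c0 cq).
have alE : fine (mu A) = al by rewrite muA.
have intE : \int[mu]_y \1_A y = al.
  by rewrite /Rintegral integral_indic// setIT alE.
rewrite alE in x1; rewrite intE in x2.
have AE (y : shift_space) : A y = (y 0 = true).
  by rewrite /A /cyl /= andbT; apply/propext; split=> /eqP.
(* The index is moved by one so that x_0 = 1 puts 1 in [S]. *)
pose S := [set n | (0 < n)%N /\ x (n.-1)%:Z = true].
have SE n : (n.+1 \in S) = x n%:Z.
  by apply/idP/idP => [/set_mem[]//|xn]; apply/mem_set; split.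
exists S; split.
- by move=> n [].
- exists al; split=> //; rewrite /has_density; apply: cvg_trans x1.
  apply: near_eq_cvg; near=> n; rewrite freqE; congr (_ / _).
  rewrite big_add1 /= big_mkord; apply: eq_bigr => j _.
  rewrite SE indicE; congr ((nat_of_bool _)%:R).
  have -> : x j = iter j left_shift x 0 by rewrite iter_shift add0r.
  by apply/idP/idP => [/set_mem|h]; [rewrite AE|apply/mem_set; rewrite AE].
- move=> s m [s0 xs] [_ xsm] m0; apply: contrapT => nM; apply: (x3 m s.-1 m0 nM); split=> //.
  by rewrite (_ : s.-1 + m = (s + m).-1)%N//; lia.
apply: le_trans cq _.
have := @cvg_le_limn_sup R _ (freq01 R [set n | (0 < n)%N /\ S `&` shift_down S (a n) !=set0]) _ al _ x2.
apply=> N; rewrite freqE mulrC ler_wpM2r ?invr_ge0//.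
apply: ler_sum_nat => n /andP[n0 _]; rewrite indicE ler_nat.
case: (boolP (_ \in A)) => // /set_mem; rewrite AE iter_shift add0r => xa.
rewrite mem_set//=; split=> //; exists 1%N; split; first by split; [|move: xA; rewrite AE].
by split=> //; rewrite /S /= add1n.
Unshelve. all: by end_near. Qed.

End ReturnSet.

(** * Weyl differencing for averages of cosines *)

Section Means.
Variable R : realType.

(** All averages below, nested or over several scales, are handled through
    these three properties. *)
Record is_mean (T : Type) (L : (T -> R) -> R) : Prop := IsMean {
  mean_linear : forall (a : R) (u v : T -> R), L (fun t => a * u t + v t) = a * L u + L v;
  mean_ge0 : forall u : T -> R, (forall t, 0 <= u t) -> 0 <= L u;
  mean_one : L (fun=> 1) = 1 }.

Section MeanTheory.
Variables (T : Type) (L : (T -> R) -> R).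
Hypothesis mL : is_mean L.

Lemma mean0 : L (fun=> 0) = 0.
Proof.
have := mean_linear mL 1 (fun=> 0) (fun=> 0); under eq_fun do rewrite mul1r addr0.
by rewrite mul1r => h; apply: (addrI (L (fun=> 0))); rewrite addr0 -h.
Qed.

Lemma meanZ a u : L (fun t => a * u t) = a * L u.
Proof.
have := mean_linear mL a u (fun=> 0); rewrite mean0 addr0 => <-.
by congr L; apply/funext => t; rewrite addr0.
Qed.

Lemma meanD u v : L (fun t => u t + v t) = L u + L v.
Proof.
have := mean_linear mL 1 u v; rewrite mul1r => <-.
by congr L; apply/funext => t; rewrite mul1r.
Qed.

Lemma meanN u : L (fun t => - u t) = - L u.
Proof.
by rewrite -mulN1r -meanZ; congr L; apply/funext => t; rewrite mulN1r.
Qed.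

Lemma mean_cst a : L (fun=> a) = a.
Proof.
by have := meanZ a (fun=> 1); rewrite (mean_one mL) mulr1.
Qed.

Lemma mean_sum (I : Type) (s : seq I) (P : pred I) (u : I -> T -> R) :
  L (fun t => \sum_(i <- s | P i) u i t) = \sum_(i <- s | P i) L (u i).
Proof.
elim: s => [|i s IH]; first by under eq_fun do rewrite big_nil; rewrite mean0 big_nil.
under eq_fun do rewrite big_cons; rewrite big_cons.
by case: (P i) => //; rewrite meanD IH.
Qed.

Lemma ler_mean u v : (forall t, u t <= v t) -> L u <= L v.
Proof.
move=> uv; rewrite -subr_ge0 -meanN -meanD; apply: (mean_ge0 mL) => t.
by rewrite subr_ge0.
Qed.

Lemma ler_norm_mean u e : (forall t, `|u t| <= e) -> `|L u| <= e.
Proof.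
move=> ue; rewrite ler_norml; apply/andP; split.
  have : L (fun=> - e) <= L u.
    by apply: ler_mean => t; move: (ue t); rewrite ler_norml => /andP[].
  by rewrite mean_cst.
have : L u <= L (fun=> e).
  by apply: ler_mean => t; move: (ue t); rewrite ler_norml => /andP[].
by rewrite mean_cst.
Qed.

Lemma mean_dist u v e : (forall t, `|u t - v t| <= e) -> `|L u - L v| <= e.
Proof. by move=> uv; rewrite -meanN -meanD; exact: ler_norm_mean. Qed.

Lemma sqr_mean u : (L u) ^+ 2 <= L (fun t => u t ^+ 2).
Proof.
have := mean_ge0 mL (fun t => sqr_ge0 (u t - L u)).
have -> : (fun t => (u t - L u) ^+ 2) =
          (fun t => u t ^+ 2 + ((- 2 * L u) * u t + L u ^+ 2)).
  by apply/funext => t; ring.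
rewrite meanD meanD meanZ mean_cst; lra.
Qed.

End MeanTheory.

Definition avg (H : nat) (u : nat -> R) : R := (\sum_(x < H) u x) / H%:R.

Lemma avg_mean H : (0 < H)%N -> is_mean (avg H).
Proof.
move=> H0; have HR : H%:R != 0 :> R by rewrite pnatr_eq0 -lt0n.
split.
- by move=> a u v; rewrite /avg big_split/= -mulr_sumr mulrDl mulrA.
- by move=> u u0; rewrite divr_ge0// sumr_ge0.
- by rewrite /avg sumr_const card_ord divff.
Qed.

Lemma mean_comp (T U : Type) (L : (T -> R) -> R) (M : T -> (U -> R) -> R) :
  is_mean L -> (forall t, is_mean (M t)) -> is_mean (fun u => L (fun t => M t u)).
Proof.
move=> mL mM; split.
- move=> a u v; rewrite -(mean_linear mL); congr L; apply/funext => t.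
  exact: mean_linear.
- by move=> u u0; apply: (mean_ge0 mL) => t; exact: mean_ge0.
- by under eq_fun do rewrite (mean_one (mM _)); exact: mean_one.
Qed.

Lemma mean_map (T U : Type) (L : (T -> R) -> R) (f : T -> U) :
  is_mean L -> is_mean (fun u : U -> R => L (fun t => u (f t))).
Proof.
move=> mL; split.
- by move=> a u v; rewrite (mean_linear mL).
- by move=> u u0; apply: (mean_ge0 mL).
- exact: mean_one.
Qed.

Lemma mean_avgC (T : Type) (L : (T -> R) -> R) H (u : nat -> T -> R) : is_mean L ->
  L (fun t => avg H (fun x => u x t)) = avg H (fun x => L (u x)).
Proof.
move=> mL; rewrite /avg -(mean_sum mL) mulrC -(meanZ mL).
by congr L; apply/funext => t; rewrite mulrC.
Qed.

(** Cauchy-Schwarz, then (avg cos)^2 + (avg sin)^2 = avg avg cos of the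
    differences. *)
Lemma vdc (T : Type) (L : (T -> R) -> R) H (f : nat -> T -> R) : is_mean L -> (0 < H)%N ->
  (L (fun t => avg H (fun x => cos (f x t)))) ^+ 2 <=
  avg H (fun x => avg H (fun y => L (fun t => cos (f x t - f y t)))).
Proof.
move=> mL H0; apply: le_trans (sqr_mean mL _) _.
have -> : avg H (fun x => avg H (fun y => L (fun t => cos (f x t - f y t)))) =
    L (fun t => avg H (fun x => avg H (fun y => cos (f x t - f y t)))).
  by rewrite (mean_avgC _ _ mL); congr (avg H _); apply/funext => x; rewrite (mean_avgC _ _ mL).
apply: ler_mean => // t.
have -> : avg H (fun x => avg H (fun y => cos (f x t - f y t))) =
   (avg H (fun x => cos (f x t))) ^+ 2 + (avg H (fun x => sin (f x t))) ^+ 2.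
  have HH := avg_mean H0.
  rewrite !expr2 -!(meanZ HH) -(meanD HH); congr (avg H _); apply/funext => x.
  rewrite ![avg H _ * _]mulrC -!(meanZ HH) -(meanD HH).
  by congr (avg H _); apply/funext => y; rewrite cosB.
by rewrite lerDl sqr_ge0.
Qed.

(** The average of [u] over the sums x_1 + ... + x_V with all x_i < H. With
    independent variables, differencing in one of them leaves the ranges of
    the others unchanged. *)
Fixpoint havg (H V : nat) (u : nat -> R) : R :=
  if V is V'.+1 then avg H (fun x => havg H V' (fun y => u (x + y)%N)) else u 0%N.

Lemma havg_mean H V : (0 < H)%N -> is_mean (havg H V).
Proof.
move=> H0; elim: V => [|V IH] /=; first by split.
exact: (mean_comp (avg_mean H0) (fun x => mean_map (fun y => (x + y)%N) IH)).
Qed.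

Lemma coef_comp_shift (F : {poly R}) c s j : (size F <= s.+1)%N ->
  (F \Po ('X + c%:P))`_j = \sum_(i < s.+1) F`_i * (c ^+ (i - j) *+ 'C(i, j)).
Proof.
move=> sF; rewrite comp_polyE coef_sum (big_ord_widen _ (fun i => (F`_i *: (('X + c%:P) ^+ i))`_j) sF) big_mkcond /=.
apply: eq_bigr => i _; rewrite coefZ; case: ifPn => [_|].
  rewrite addrC exprDn coef_sum; congr (_ * _).
  under eq_bigr do rewrite -rmorphXn coefMn coefCM coefXn mulr_natr.
  have [ji|ij] := ltnP j i.+1.
    rewrite (bigD1 (Ordinal ji))//= eqxx mulr1n big1 ?addr0// => k /eqP kj.
    by case: eqP => [jk|_]; [exfalso; apply: kj; apply/val_inj|rewrite mulr0n mul0rn].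
  rewrite bin_small// mulr0n big1// => k _; case: eqP => [jk|_].
    by move: (ltn_ord k); rewrite -jk ltnNge ij.
  by rewrite mulr0n mul0rn.
by rewrite -leqNgt => /(nth_default 0) ->; rewrite !mul0r.
Qed.

(** Differencing lowers the degree by one and multiplies the top coefficient
    by the degree and by a - b. *)
Lemma shift_diff (F : {poly R}) a b s : (size F <= s.+2)%N ->
  let G := (F \Po ('X + a%:P)) - (F \Po ('X + b%:P)) in
  (size G <= s.+1)%N /\ G`_s = s.+1%:R * (a - b) * F`_s.+1.
Proof.
move=> sF G; split.
  apply/leq_sizeP => j sj; rewrite /G coefB !(coef_comp_shift _ _ sF) -sumrB big1// => i _.
  move: sj; rewrite leq_eqVlt => /orP[/eqP <-|sj].
    have [ilt|] := ltnP i s.+1; first by rewrite bin_small// !mulr0n subrr.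
    move=> si; have -> : (i - s.+1 = 0)%N by have := ltn_ord i; lia.
    by rewrite !expr0 subrr.
  by rewrite bin_small ?mulr0n ?subrr//; have := ltn_ord i; lia.
rewrite /G coefB !(coef_comp_shift _ _ sF) -sumrB !big_ord_recr/= big1.
  rewrite subnn subSnn binn binSn !expr0 !expr1 -[a *+ _]mulr_natr -[b *+ _]mulr_natr.
  by move: (s.+1%:R) (F`_s) (F`_s.+1) => x y z; rewrite mulr1n; ring.
by move=> i _; rewrite bin_small// !mulr0n subrr.
Qed.

Lemma size_comp_shift (F : {poly R}) c s : (size F <= s.+1)%N ->
  (size (F \Po ('X + c%:P)) <= s.+1)%N /\ (F \Po ('X + c%:P))`_s = F`_s.
Proof.
move=> sF; split.
  apply/leq_sizeP => j sj; rewrite (coef_comp_shift _ _ sF) big1// => i _.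
  by rewrite bin_small ?mulr0n ?mulr0//; exact: leq_trans (ltn_ord i) sj.
rewrite (coef_comp_shift _ _ sF) big_ord_recr/= subnn binn mulr1n mulr1 big1 ?add0r// => i _.
by rewrite bin_small ?ltn_ord// mulr0n mulr0.
Qed.

Lemma horner_shift (F : {poly R}) (x y : nat) :
  (F \Po ('X + x%:R%:P)).[y%:R] = F.[(x + y)%N%:R].
Proof. by rewrite horner_comp hornerD hornerX hornerC natrD addrC. Qed.

(** Weyl's inequality in qualitative form, uniform in all coefficients but the
    top one. Each of s differencings lowers the degree by one and costs the
    diagonal x = y, which has proportion 1 / H; the remaining V - s variables
    are only translations. After s steps only the top coefficient is left,
    multiplied by a nonzero integer of size at most s! H^s. *)
Lemma weyl V (e : R) : 0 < e ->
  exists H0 : nat, exists2 e0 : R, 0 < e0 &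
  forall H, (H0 < H)%N -> forall (T : Type) (L : (T -> R) -> R), is_mean L ->
  forall s, (s <= V)%N -> forall F : T -> {poly R}, (forall t, (size (F t) <= s.+1)%N) ->
  (forall D : int, D != 0 -> (`|D| <= s`! * H ^ s)%N ->
     forall c : R, `|L (fun t => cos ((F t)`_s * D%:~R + c))| <= e0) ->
  forall c, `|L (fun t => havg H V (fun h => cos ((F t).[h%:R] + c)))| <= e.
Proof.
elim: V e => [|V IH] e e_gt0.
  exists 0%N, e => // H H0 T L mL s; rewrite leqn0 => /eqP -> F sF hyp c /=.
  have := hyp 1 isT; rewrite fact0 expn0 => /(_ isT c).
  by under eq_fun do rewrite mulr1 -horner_coef0.
pose e' := Num.min e (e ^+ 2 / 2).
have e'0 : 0 < e' by rewrite lt_min e_gt0 divr_gt0// exprn_gt0.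
have [H0' [e0 e0_gt0 hH0']] := IH e' e'0.
exists (maxn H0' (Num.truncn (2 / e ^+ 2)).+1), e0 => // H.
rewrite gtn_max => /andP[H0'H eH] T L mL s sV F sF hyp c.
have H0 : (0 < H)%N by exact: leq_ltn_trans H0'H.
have eH' : H%:R^-1 <= e ^+ 2 / 2.
  rewrite -[leRHS]invrK lef_pV2 ?posrE ?invr_gt0 ?divr_gt0 ?exprn_gt0 ?ltr0n//.
  rewrite invf_div; apply: ltW (lt_le_trans (truncnS_gt _) _).
  by rewrite ler_nat ltnW.
have mA := avg_mean H0.
rewrite /=; move: sV; rewrite leq_eqVlt => /orP[/eqP sV|sV].
  rewrite {}sV {s} in sF hyp.
  pose L' (u : T * nat -> R) := L (fun t => havg H V (fun h => u (t, h))).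
  have mL' : is_mean L'.
    exact: (mean_comp mL (fun t => mean_map (fun h => (t, h)) (havg_mean V H0))).
  have := @vdc _ L' H (fun x (p : T * nat) => (F p.1).[(x + p.2)%N%:R] + c) mL' H0.
  have -> : L' (fun p => avg H (fun x => cos ((F p.1).[(x + p.2)%N%:R] + c))) =
     L (fun t => avg H (fun x => havg H V (fun h => cos ((F t).[(x + h)%N%:R] + c)))).
    rewrite /L'; congr L; apply/funext => t.
    by rewrite (mean_avgC _ _ (havg_mean V H0)).
  set S := L _ => hS.
  suff : S ^+ 2 <= e ^+ 2.
    by rewrite -real_normK ?num_real// ler_pXn2r ?nnegrE ?(ltW e_gt0).
  apply: le_trans hS _.
  apply: le_trans (_ : avg H (fun x => avg H (fun y => (x == y)%:R + e ^+ 2 / 2)) <= _).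
    rewrite /avg ler_pM2r ?invr_gt0 ?ltr0n//; apply: ler_sum => x _.
    rewrite ler_pM2r ?invr_gt0 ?ltr0n//; apply: ler_sum => y _.
    case: eqP => [->|/eqP xy].
      apply: le_trans (_ : 1 <= _); last by rewrite lerDl divr_ge0// sqr_ge0.
      rewrite -[leRHS](mean_cst mL'); apply: ler_mean => // p; exact: cos_le1.
    rewrite add0r; apply: le_trans (ler_norm _) _.
    pose G t := ((F t) \Po ('X + (x%:R)%:P)) - ((F t) \Po ('X + (y%:R)%:P)).
    have -> : L' (fun p => cos ((F p.1).[(x + p.2)%N%:R] + c - ((F p.1).[(y + p.2)%N%:R] + c))) =
       L (fun t => havg H V (fun h => cos ((G t).[h%:R] + 0))).
      congr L; apply/funext => t; congr (havg H V _); apply/funext => h /=; congr cos.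
      by rewrite addr0 /G hornerD hornerN !horner_shift; ring.
    apply: le_trans (_ : e' <= _); last by rewrite ge_min lexx orbT.
    apply: (hH0' _ H0'H _ _ mL V (leqnn V)).
      by move=> t; case: (shift_diff x%:R y%:R (sF t)).
    move=> D D0 DV c'.
    have xy0 : x%:Z - y%:Z != 0 by rewrite subr_eq0 eqz_nat.
    have D'0 : (V.+1%:Z * (x%:Z - y%:Z)) * D != 0 by rewrite !mulf_neq0.
    have := hyp _ D'0; rewrite !abszM.
    have xyH : (`|(x%:Z - y%:Z)%R| <= H)%N by have := ltn_ord x; have := ltn_ord y; lia.
    rewrite absz_nat factS expnS.
    have bnd : (V.+1 * `|(x%:Z - y%:Z)%R| * `|D| <= V.+1 * V`! * (H * H ^ V))%N.
      rewrite -!mulnA leq_mul2l /=.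
      rewrite [(V`! * _)%N]mulnCA; exact: leq_mul.
    move=> /(_ bnd c').
    congr (`| _ | <= _); congr L; apply/funext => t; congr (cos (_ + _)).
    have [_ ->] := shift_diff x%:R y%:R (sF t).
    rewrite !rmorphM rmorphB /= -!pmulrn; ring.
  have HR : H%:R != 0 :> R by rewrite pnatr_eq0 -lt0n.
  have -> : avg H (fun x => avg H (fun y => (x == y)%:R + e ^+ 2 / 2)) =
     avg H (fun x => (x < H)%:R / H%:R) + e ^+ 2 / 2.
    rewrite -[X in _ = _ + X](mean_cst mA) -(meanD mA); congr (_ / _).
    apply: eq_bigr => x _; rewrite (meanD mA) (mean_cst mA); congr (_ / _ + _).
    rewrite ltn_ord (bigD1 x)//= eqxx big1 ?addr0// => y; rewrite eq_sym => xy.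
    by case: eqP => // /val_inj /eqP; rewrite (negbTE xy).
  have -> : avg H (fun x => (x < H)%:R / H%:R) = H%:R^-1.
    rewrite -[RHS](mean_cst mA) /avg; congr (_ / _); apply: eq_bigr => x _.
    by rewrite ltn_ord mul1r.
  lra.
rewrite (mean_avgC _ _ mL).
apply: (ler_norm_mean mA) => x.
pose G t := (F t) \Po ('X + (x%:R)%:P).
have -> : (fun t => havg H V (fun y => cos ((F t).[(x + y)%N%:R] + c))) =
   (fun t => havg H V (fun y => cos ((G t).[y%:R] + c))).
  by apply/funext => t; congr (havg H V _); apply/funext => y; rewrite horner_shift.
apply: le_trans (_ : e' <= _); last by rewrite ge_min lexx.
apply: (hH0' _ H0'H _ _ mL s) => // t.
  by case: (size_comp_shift x%:R (sF t)).
move=> D0 Ds c'.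
have := hyp t D0 Ds c'; congr (`| _ | <= _); congr L; apply/funext => z.
by have [_ ->] := size_comp_shift x%:R (sF z).
Qed.

End Means.

(** * Local Taylor polynomials and sums over progressions *)

Section Calculus.
Variable R : realType.

Lemma lipschitz_segment (h h' : R -> R) (a b C : R) : a <= b ->
  (forall x, a <= x <= b -> is_derive x (1 : R) h (h' x)) ->
  (forall x, a <= x <= b -> `|h' x| <= C) -> `|h b - h a| <= C * (b - a).
Proof.
move=> ab dh hC.
have [||c] := @MVT_segment R h h' a b ab.
- by move=> x; rewrite in_itv/= => /andP[/ltW ax /ltW xb]; apply: dh; rewrite ax.
- apply: derivable_within_continuous => x; rewrite in_itv/= => axb.
  by have := dh x axb => dhx; exact: ex_derive.
rewrite in_itv/= => acb ->; rewrite normrM [`|b - a|]ger0_norm ?subr_ge0//.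
by rewrite ler_wpM2r ?subr_ge0// hC.
Qed.

Lemma cos_lipschitz (x y : R) : `|cos x - cos y| <= `|x - y|.
Proof.
wlog xy : x y / y <= x.
  by move=> h; have [/h//|/ltW/h] := leP y x; rewrite distrC [`|y - x|]distrC.
have := @lipschitz_segment cos (fun z => - sin z) y x 1 xy.
rewrite mul1r [`|x - y|]ger0_norm ?subr_ge0//; apply.
move=> z _; rewrite normrN; have := cos2Dsin2 z; have := sqr_ge0 (cos z) => c0 cs.
  rewrite -(@ler_pXn2r _ 2)// ?nnegrE// real_normK ?num_real// expr1n; lra.
Qed.

Lemma sin_ge_half (x : R) : 0 <= x <= 1 / 2 -> x / 2 <= sin x.
Proof.
move=> /andP[x0 x1].
have [|c] := @MVT_segment R sin cos 0 x x0.
  by apply: derivable_within_continuous => z _; exact: derivable_sin.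
rewrite in_itv/= => /andP[c0 cx]; rewrite sin0 !subr0 => ->.
rewrite [leRHS]mulrC ler_wpM2l//.
have := cos_lipschitz c 0; rewrite cos0 subr0 [`|c|]ger0_norm// ler_norml; lra.
Qed.

(** The Dirichlet kernel: after multiplication by 2 sin (x / 2) the sum
    telescopes. *)
Lemma sum_cos_arith (c x : R) J :
  2 * sin (x / 2) * \sum_(j < J) cos (c + j%:R * x) =
  sin (c + J%:R * x - x / 2) - sin (c - x / 2).
Proof.
elim: J => [|J IH]; first by rewrite big_ord0 mulr0 mul0r addr0 subrr.
rewrite big_ord_recr /= mulrDr IH.
have -> : c + J.+1%:R * x - x / 2 = (c + J%:R * x) + x / 2 by rewrite -natr1; field.
rewrite [sin (c + J%:R * x + x / 2)]sinD [sin (c + J%:R * x - x / 2)]sinB; ring.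
Qed.

Lemma avg_cos_arith (c x : R) J : (0 < J)%N -> 0 < `|x| <= 1 ->
  `|avg J (fun j => cos (c + j%:R * x))| <= 4 / (J%:R * `|x|).
Proof.
move=> J0 /andP[x0 x1].
have JR : 0 < J%:R :> R by rewrite ltr0n.
have sx : `|x| / 4 <= `|sin (x / 2)|.
  wlog xpos : x x0 x1 / 0 < x.
    move=> h; have [|xneg|xe] := ltgtP 0 x; first exact: h.
      by have := h (- x); rewrite normrN mulNr sinN normrN; apply; rewrite // oppr_gt0.
    by rewrite -xe normr0 ltxx in x0.
  rewrite gtr0_norm// in x0 x1 *.
  have := @sin_ge_half (x / 2); move=> H; have {H} : x / 2 / 2 <= sin (x / 2) by apply: H; lra.
  move=> H; rewrite ger0_norm; lra.
have sx0 : 0 < `|sin (x / 2)| by apply: lt_le_trans sx; lra.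
have h : `|2 * sin (x / 2)| * `|\sum_(j < J) cos (c + j%:R * x)| <= 2.
  rewrite -normrM sum_cos_arith; apply: le_trans (ler_normB _ _) _.
  have sin1 (z : R) : `|sin z| <= 1 by exact: sin_max.
  by apply: le_trans (lerD (sin1 _) (sin1 _)) _; lra.
rewrite normrM gtr0_norm// in h.
rewrite /avg; set S := \sum_(j < J) _ in h *.
rewrite normrM normfV [`|J%:R|]gtr0_norm// invfM mulrA.
rewrite mulrAC ler_pM2r ?invr_gt0// ler_pdivlMr//.
have : `|x| / 4 * `|S| <= `|sin (x / 2)| * `|S| by rewrite ler_wpM2r.
lra.
Qed.

End Calculus.

Section Taylor.
Variables (R : realType) (l : nat) (f : nat -> R -> R) (X : R).
Hypothesis df : forall m x, (m <= l)%N -> X <= x -> is_derive x (1 : R) (f m) (f m.+1 x).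

Definition taylor m j A : {poly R} := \poly_(i < j) (f (m + i) A / i`!%:R).

(** Induction on the number of terms: the derivative of the error is the error
    of the next function in the chain. *)
Lemma taylor_err j m A W rho : (m + j = l.+1)%N -> X <= A -> 0 <= W ->
  (forall x, A <= x -> `|f l.+1 x| <= rho) ->
  forall y, 0 <= y <= W -> `|f m (A + y) - (taylor m j A).[y]| <= rho * W ^+ j.
Proof.
move=> mj XA W0 hrho; elim: j m mj => [|j IH] m mj y /andP[y0 yW].
  have -> : taylor m 0 A = 0 by apply/polyP => i; rewrite /taylor coef_poly ltn0 coef0.
  rewrite horner0 subr0 expr0 mulr1 -(addn0 m) mj; apply: hrho; lra.
have mj' : (m.+1 + j = l.+1)%N by rewrite addSn -addnS.
pose h z := f m (A + z) - (taylor m j.+1 A).[z].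
have h0 : h 0 = 0.
  by rewrite /h addr0 horner_coef0 coef_poly /= addn0 fact0 divr1 subrr.
have dT : (taylor m j.+1 A)^`() = taylor m.+1 j A.
  apply/polyP => i; rewrite coef_deriv !coef_poly ltnS; case: ifP => _; last by rewrite mul0rn.
  rewrite addSnnS factS natrM -mulr_natr; field.
  by rewrite pnatr_eq0 -lt0n fact_gt0 addrC natr1 pnatr_eq0.
have rho0 : 0 <= rho by apply: le_trans (normr_ge0 _) (hrho A (lexx _)).
have := @lipschitz_segment R h (fun z => f m.+1 (A + z) - (taylor m.+1 j A).[z]) 0 y (rho * W ^+ j) y0.
rewrite h0 !subr0 -/(h y) => H; apply: le_trans (H _ _) _.
- move=> z /andP[z0 zy]; rewrite -dT; apply: is_deriveB.
  have dfz : is_derive (z + A) (1 : R) (f m) (f m.+1 (z + A)) by apply: df; [lia|lra].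
  rewrite [A + z]addrC.
  have -> : (fun z => f m (A + z)) = f m \o shift A by apply/funext => w /=; rewrite addrC.
  have := @is_derive1_comp R (f m) (shift A) z _ _ dfz (is_derive_shift z 1 A).
  by rewrite mulr1.
- by move=> z /andP[z0 zy]; apply: IH => //; rewrite z0 (le_trans zy).
- by rewrite exprSr mulrA ler_wpM2l// mulr_ge0// exprn_ge0.
Qed.

End Taylor.

(** * Averages of exponentials along a slowly varying top derivative *)

Section Support.
Variable R : realType.

Lemma avg_ext H (u v : nat -> R) : (forall x, (x < H)%N -> u x = v x) -> avg H u = avg H v.
Proof. by move=> uv; rewrite /avg; congr (_ / _); apply: eq_bigr => x _; apply: uv. Qed.

Lemma havg_ext H V (u v : nat -> R) :
  (forall h, (h <= V * H)%N -> u h = v h) -> havg H V u = havg H V v.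
Proof.
elim: V u v => [|V IH] u v uv /=; first exact: uv.
by apply: avg_ext => x xH; apply: IH => h hV; apply: uv; rewrite mulSn; lia.
Qed.

(** The first index at which [u] reaches [b] will do. *)
Lemma discrete_ivt (u : nat -> R) a1 rho b : 0 <= rho ->
  (forall a, (a1 <= a)%N -> `|u a.+1 - u a| <= rho) ->
  (forall B, exists2 a, (a1 <= a)%N & B <= u a) -> u a1 <= b ->
  exists2 a, (a1 <= a)%N & `|u a - b| <= rho.
Proof.
move=> rho0 step unb ub.
have ex : exists a, (a1 <= a)%N && (b <= u a).
  by have [a a1a ba] := unb b; exists a; rewrite a1a.
case: (ex_minnP ex) => a /andP[a1a ba] amin.
exists a => //; move: a1a; rewrite leq_eqVlt => /orP[/eqP aE|lta].
  by rewrite -aE (_ : u a1 = b) ?subrr ?normr0//; apply/le_anti; rewrite ub aE ba.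
case: a lta ba amin => // a lta ba amin.
have : u a < b.
  by rewrite ltNge; apply/negP => bua; have := amin a; rewrite bua andbT ltnn => /(_ lta).
have := step a lta; rewrite !ler_norml; lra.
Qed.

End Support.

Section Scale.
Variables (R : realType) (l n : nat) (f : nat -> R -> R) (X delta Theta : R) (a0 : nat).
Hypothesis Theta0 : 0 < Theta.
Hypothesis df : forall m x, (m <= l)%N -> X <= x -> is_derive x (1 : R) (f m) (f m.+1 x).
Hypothesis flim0 : forall e : R, 0 < e -> exists Y, forall x, Y <= x -> `|f l.+1 x| <= e.
Variable sg : R.
Hypothesis sg1 : `|sg| = 1.
Hypothesis flimy : forall B : R, exists Y, forall x, Y <= x -> B <= sg * f l x.

(** The coefficients of the phase when sum_i theta_i g(a+i) is expanded in
    derivatives of g at a; see [phase_expansion]. *)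
Definition phi (theta : 'I_n.+1 -> R) m := \sum_i theta i * i%:R ^+ m.

Definition phase (theta : 'I_n.+1 -> R) (a : nat) :=
  \sum_i theta i * (f 0 (a + i)%N%:R - delta).

Let phiM := Theta * n.+1%:R * n.+1%:R ^+ l.

Lemma phiM_gt0 : 0 < phiM.
Proof. by rewrite !mulr_gt0// exprn_gt0. Qed.

Lemma norm_phi_le theta m : (forall i, `|theta i| <= Theta) -> (m <= l)%N ->
  `|phi theta m| <= phiM.
Proof.
move=> hth ml; apply: le_trans (ler_norm_sum _ _ _) _.
apply: le_trans (_ : \sum_(i < n.+1) Theta * n.+1%:R ^+ l <= _).
  apply: ler_sum => i _; rewrite normrM; apply: ler_pM => //.
  rewrite normrX ger0_norm//; apply: le_trans (_ : n.+1%:R ^+ m <= _).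
    by apply: lerXn2r; rewrite ?nnegrE// ler_nat ltnW.
  by apply: ler_weXn2l => //; rewrite ler1n.
  by rewrite sumr_const card_ord -[leLHS]mulr_natr /phiM mulrAC.
Qed.

Let q A := taylor f 0 l.+1 A.

(** Replace g by its Taylor polynomial at A and expand that polynomial once
    more at A + h. *)
Lemma phase_expansion theta A h W rho : (forall i, `|theta i| <= Theta) ->
  X <= A%:R -> (forall x, A%:R <= x -> `|f l.+1 x| <= rho) -> (h + n <= W)%N ->
  `|phase theta (A + h) -
    (\sum_(m < l.+1) phi theta m * ((q A%:R)^`N(m)).[h%:R] - delta * phi theta 0)|
    <= n.+1%:R * Theta * (rho * W%:R ^+ l.+1).
Proof.
move=> hth XA hrho hW.
have -> : \sum_(m < l.+1) phi theta m * ((q A%:R)^`N(m)).[h%:R] - delta * phi theta 0 =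
    \sum_i theta i * ((q A%:R).[(h + i)%N%:R] - delta).
  under [RHS]eq_bigr do rewrite mulrBr.
  rewrite sumrB; congr (_ - _); last first.
    by rewrite /phi mulr_sumr; apply: eq_bigr => i _; rewrite expr0 mulr1 mulrC.
  rewrite /phi; under eq_bigr do rewrite mulr_suml.
  rewrite exchange_big /=; apply: eq_bigr => i _.
  rewrite natrD (@nderiv_taylor_wide _ l.+1) ?size_poly//; last exact: mulrC.
  by rewrite mulr_sumr; apply: eq_bigr => m _; ring.
rewrite -sumrB; apply: le_trans (ler_norm_sum _ _ _) _.
apply: le_trans (_ : \sum_(i < n.+1) Theta * (rho * W%:R ^+ l.+1) <= _); last first.
  by rewrite sumr_const card_ord -[leLHS]mulr_natl mulrA.
apply: ler_sum => i _; rewrite -mulrBr normrM ler_pM//.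
have -> : f 0 (A + h + i)%N%:R - delta - ((q A%:R).[(h + i)%N%:R] - delta) =
          f 0 (A%:R + (h + i)%N%:R) - (q A%:R).[(h + i)%N%:R].
  by rewrite -addnA natrD; ring.
apply: (@taylor_err R l f X df l.+1 0 A%:R W%:R rho (erefl _) XA _ hrho) => //.
rewrite ler0n ler_nat; have := ltn_ord i; lia.
Qed.

(** The part of the expanded phase that remains after discarding the indices m
    < j. *)
Definition tail_poly theta j A := \sum_(m < l.+1 | (j <= m)%N) phi theta m *: (q A)^`N(m).

Lemma tail_poly_size theta j A s : (j + s = l)%N ->
  (size (tail_poly theta j A) <= s.+1)%N /\
  (tail_poly theta j A)`_s = phi theta j * ('C(l, j)%:R / l`!%:R) * f l A.
Proof.
move=> jsl; have qcoef i : (q A)`_i = if (i <= l)%N then f i A / i`!%:R else 0.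
  by rewrite coef_poly ltnS add0n.
split.
  apply/leq_sizeP => i si; rewrite coef_sum big1// => m jm.
  rewrite coefZ coef_nderivn qcoef (_ : (m + i <= l)%N = false); last lia.
  by rewrite mul0rn mulr0.
have jl : (j < l.+1)%N by lia.
rewrite coef_sum (bigD1 (Ordinal jl))//= big1 ?addr0.
  rewrite coefZ coef_nderivn qcoef jsl leqnn -mulr_natr; ring.
move=> m /andP[jm /eqP mj]; rewrite coefZ coef_nderivn qcoef (_ : (m + s <= l)%N = false).
  by rewrite mul0rn mulr0.
suff : (m : nat) <> j by lia.
by move=> e; apply: mj; apply/val_inj.
Qed.

Definition supported_on a1 a2 (L : (nat -> R) -> R) :=
  forall u v, (forall a, (a1 <= a <= a2)%N -> u a = v a) -> L u = L v.

(** The average over a = A_t + h, where h is a sum of l variables and the base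
    points A_t are such that the top derivative at A_t follows an arithmetic
    progression in t up to rho. If all phi_m are below kappa', the phase is
    small. Otherwise let j be the first index with phi_j not below kappa'; the
    terms m < j are negligible, the rest has degree l - j in h, and its top
    coefficient is phi_j times an arithmetic progression in t, so [weyl]
    applies. *)
Lemma single_scale (kappa e : R) : 0 < kappa -> 0 < e ->
  exists L : (nat -> R) -> R, exists kappa' : R, exists amax : nat,
  [/\ is_mean L, supported_on a0 amax L, 0 < kappa' <= kappa &
    forall theta, (forall i, `|theta i| <= Theta) ->
    (forall m, (m <= l)%N -> `|phi theta m| <= kappa' \/ kappa <= `|phi theta m|) ->
    - e <= L (fun a => cos (phase theta a))].
Proof.
move=> kappa0 e0.
pose e1 := Num.min (1 / 4) (e / 8).
have e10 : 0 < e1 by rewrite lt_min; apply/andP; split; lra.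
have e14 : e1 <= 1 / 4 by rewrite ge_min lexx.
have e18 : e1 <= e / 8 by rewrite ge_min lexx orbT.
have e20 : 0 < e / 2 by lra.
have [H0 [ew ew0 hweyl]] := @weyl R l (e / 2) e20.
pose H := H0.+1.
have [xM xM0 xME] : exists2 xM : R, 0 < xM & xM = phiM * (l`!%:R * (l`!%:R * H%:R ^+ l)).
  eexists; last reflexivity.
  by rewrite mulr_gt0 ?phiM_gt0// !mulr_gt0 ?exprn_gt0// ltr0n ?fact_gt0.
have [xm xm0 xmE] : exists2 xm : R, 0 < xm & xm = kappa / l`!%:R.
  by eexists; last reflexivity; rewrite divr_gt0// ltr0n fact_gt0.
(* The step of the progression: small enough that the arguments of the
   geometric sums stay below 1, far from the period of the cosine. *)
pose eta := xM^-1.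
have eta0 : 0 < eta by rewrite invr_gt0.
pose J := (Num.truncn (8 / (ew * (xm * eta)))).+1.
have J0 : 0 < J%:R :> R by rewrite ltr0n.
have hJ : 4 / (J%:R * (xm * eta)) <= ew / 2.
  have xe : 0 < xm * eta by rewrite mulr_gt0.
  rewrite ler_pdivrMr ?mulr_gt0//.
  have : 8 / (ew * (xm * eta)) <= J%:R by apply: ltW; exact: truncnS_gt.
  by rewrite ler_pdivrMr ?mulr_gt0//; lra.
pose W := (l * H + n)%N.
have [rho rho0 [rho1 rho2]] : exists2 rho : R, 0 < rho &
    xM * rho <= ew / 2 /\ n.+1%:R * Theta * (rho * W%:R ^+ l.+1) <= e1.
  have K0 : 0 < n.+1%:R * Theta * (W%:R ^+ l.+1 + 1).
    by rewrite !mulr_gt0// ltr_wpDl// exprn_ge0.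
  exists (Num.min (ew / 2 / xM) (e1 / (n.+1%:R * Theta * (W%:R ^+ l.+1 + 1)))).
    by rewrite lt_min !divr_gt0.
  split.
    rewrite mulrC -ler_pdivlMr// ge_min lexx//.
  apply: le_trans (_ : n.+1%:R * Theta * ((e1 / (n.+1%:R * Theta * (W%:R ^+ l.+1 + 1))) *
     (W%:R ^+ l.+1 + 1)) <= _).
    rewrite ler_wpM2l ?mulr_ge0 ?(ltW Theta0)// ler_pM//.
    - by rewrite le_min !divr_ge0// ltW.
    - by rewrite ge_min lexx orbT.
    - by rewrite lerDl.
  by rewrite mulrCA divfK ?gt_eqF//.
have [Y1 hY1] := flim0 rho0.
pose a1 := maxn a0 (Num.truncn (Num.max X Y1)).+1.
have a1XY : Num.max X Y1 <= a1%:R.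
  by apply: ltW (lt_le_trans (truncnS_gt _) _); rewrite ler_nat leq_maxr.
have [a1X a1Y] : X <= a1%:R /\ Y1 <= a1%:R by move: a1XY; rewrite ge_max => /andP.
pose u (a : nat) := sg * f l a%:R.
have step a : (a1 <= a)%N -> `|u a.+1 - u a| <= rho.
  move=> a1a; have a1aR : a1%:R <= a%:R :> R by rewrite ler_nat.
  rewrite /u -mulrBr normrM sg1 mul1r.
  have := @lipschitz_segment R (f l) (f l.+1) a%:R a.+1%:R rho.
  rewrite -natr1 addrAC subrr add0r mulr1; apply.
  - by rewrite lerDl.
  - by move=> x /andP[ax _]; apply: df => //; lra.
  - by move=> x /andP[ax _]; apply: hY1; lra.
have unb B : exists2 a, (a1 <= a)%N & B <= u a.
  have [Y hY] := flimy B; exists (maxn a1 (Num.truncn Y).+1); first exact: leq_maxl.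
  apply: hY; apply: ltW (lt_le_trans (truncnS_gt _) _); rewrite ler_nat; exact: leq_maxr.
have /choice[A hA] : forall j : nat, exists a, (a1 <= a)%N /\ `|u a - (u a1 + j%:R * eta)| <= rho.
  move=> j; have ub : u a1 <= u a1 + j%:R * eta by rewrite lerDl mulr_ge0// ltW.
  by have [a a1a ha] := discrete_ivt (ltW rho0) step unb ub; exists a.
have AX j : X <= (A j)%:R by apply: le_trans a1X _; rewrite ler_nat; case: (hA j).
have AY j x : (A j)%:R <= x -> `|f l.+1 x| <= rho.
  by move=> Ax; apply: hY1; apply: le_trans a1Y (le_trans _ Ax); rewrite ler_nat; case: (hA j).
pose Q j h m := ((q (A j)%:R)^`N(m)).[h%:R].
pose Bq := 1 + `|delta| + \sum_(j < J) \sum_(h < (l * H).+1) \sum_(m < l.+1) `|Q j h m|.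
have Bq1 : 1 + `|delta| <= Bq.
  by rewrite lerDl sumr_ge0// => j _; rewrite sumr_ge0// => h _; rewrite sumr_ge0.
have Bq0 : 0 < Bq by apply: lt_le_trans Bq1; have := normr_ge0 delta; lra.
have QBq j h : (j < J)%N -> (h <= l * H)%N -> \sum_(m < l.+1) `|Q j h m| <= Bq.
  move=> jJ hH; rewrite /Bq (bigD1 (Ordinal jJ))//=.
  have hH' : (h < (l * H).+1)%N by [].
  rewrite (bigD1 (Ordinal hH'))//=.
  set r1 := \sum_(_ < _ | _ != Ordinal hH') _; set r2 := \sum_(_ < _ | _ != Ordinal jJ) _.
  have r10 : 0 <= r1 by rewrite sumr_ge0// => z _; rewrite sumr_ge0.
  have r20 : 0 <= r2.
    by rewrite sumr_ge0// => z _; rewrite sumr_ge0// => y _; rewrite sumr_ge0.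
  by have := normr_ge0 delta; lra.
(* [Bq] bounds all Taylor coefficients occurring at this scale. *)
pose kappa' := Num.min kappa (e1 / Bq).
have k'0 : 0 < kappa' by rewrite lt_min kappa0 divr_gt0.
have k'k : kappa' <= kappa by rewrite ge_min lexx.
have k'B : kappa' * Bq <= e1 by rewrite -ler_pdivlMr// ge_min lexx orbT.
pose L (v : nat -> R) := avg J (fun j => havg H l (fun h => v (A j + h)%N)).
have mJ := @avg_mean R J isT.
have mH := @havg_mean R H l isT.
have mL : is_mean L.
  exact: (mean_comp mJ (fun j => mean_map (fun h => (A j + h)%N) mH)).
exists L, kappa', (\max_(j < J) A j + l * H)%N; split=> //.
- move=> v w vw; apply: avg_ext => j jJ; apply: havg_ext => h hH; apply: vw.
  have := @leq_bigmax 'I_J (fun j : 'I_J => A j) (Ordinal jJ) => /= hAj.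
  have [a1A _] := hA j; rewrite leq_add// andbT.
  exact: leq_trans (leq_trans (leq_maxl _ _) a1A) (leq_addr _ _).
- by rewrite k'0.
move=> theta hth gap.
have expand j h : (h <= l * H)%N -> `|phase theta (A j + h) -
    (\sum_(m < l.+1) phi theta m * Q j h m - delta * phi theta 0)| <= e1.
  move=> hH; apply: le_trans rho2; apply: phase_expansion => //; first exact: AY.
  by rewrite /W leq_add2r.
have small j h (P : pred 'I_l.+1) : (j < J)%N -> (h <= l * H)%N ->
    (forall m : 'I_l.+1, P m -> `|phi theta m| <= kappa') ->
    `|\sum_(m < l.+1 | P m) phi theta m * Q j h m| <= e1.
  move=> jJ hH hP; apply: le_trans (ler_norm_sum _ _ _) _.
  apply: le_trans (_ : \sum_(m < l.+1) kappa' * `|Q j h m| <= _).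
    rewrite big_mkcond; apply: ler_sum => m _; case: ifPn => [Pm|_].
      by rewrite normrM ler_wpM2r// hP.
    by rewrite mulr_ge0// ltW.
  rewrite -mulr_sumr; apply: le_trans k'B; rewrite ler_wpM2l ?(ltW k'0)//.
  exact: QBq.
have [allsmall|] := pselect (forall m, (m <= l)%N -> `|phi theta m| <= kappa').
  have phase_small j h : (j < J)%N -> (h <= l * H)%N -> `|phase theta (A j + h)| <= 3 * e1.
    move=> jJ hH; have := expand j h hH.
    have := small j h xpredT jJ hH (fun m _ => allsmall m (ltn_ord m)).
    have : `|delta * phi theta 0| <= e1.
      rewrite normrM; apply: le_trans k'B; rewrite [leRHS]mulrC; apply: ler_pM => //.
        by apply: le_trans Bq1; lra.
      exact: allsmall.
    move: (phase _ _) (\sum_(_ < _ | _) _) (delta * _) => x y z.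
    rewrite !ler_norml; lra.
  apply: le_trans (_ : L (fun=> 0) <= _); first by rewrite mean0//; lra.
  rewrite (_ : L (fun=> 0) = avg J (fun j => (j < J)%:R * 0)); last first.
    by apply: avg_ext => j jJ; rewrite jJ mul1r (mean0 mH).
  rewrite /L /avg ler_pM2r ?invr_gt0//; apply: ler_sum => j _.
  rewrite mulr0 (_ : havg _ _ _ =
     havg H l (fun h => if (h <= l * H)%N then cos (phase theta (A j + h)) else 1)); last first.
    by apply: havg_ext => h ->.
  apply: (mean_ge0 mH) => h; case: ifPn => // hH.
  have := cos_lipschitz (phase theta (A j + h)) 0; rewrite cos0 subr0.
  have := phase_small j h (ltn_ord j) hH.
  move: (phase _ _) => x hx; rewrite ler_norml => /andP[hc _]; lra.
move=> notsmall.
have exj : exists j, (j <= l)%N && (kappa' < `|phi theta j|).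
  apply: contrapT => nex; apply: notsmall => m ml; rewrite leNgt; apply/negP => hm.
  by apply: nex; exists m; rewrite ml.
case: (ex_minnP exj) => j0 /andP[j0l j0big] j0min.
have j0k : kappa <= `|phi theta j0| by case: (gap j0 j0l) => //; rewrite leNgt j0big.
pose s := (l - j0)%N.
have j0s : (j0 + s = l)%N by rewrite subnKC.
pose F j := tail_poly theta j0 (A j)%:R.
pose c := - (delta * phi theta 0).
have mainE j h : (j < J)%N -> (h <= l * H)%N ->
    `|cos (phase theta (A j + h)) - cos ((F j).[h%:R] + c)| <= 2 * e1.
  move=> jJ hH; apply: le_trans (cos_lipschitz _ _) _.
  have : (F j).[h%:R] = \sum_(m < l.+1 | (j0 <= m)%N) phi theta m * Q j h m.
    by rewrite horner_sum; apply: eq_bigr => m _; rewrite hornerZ.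
  have := expand j h hH; rewrite (bigID (fun m : 'I_l.+1 => (j0 <= m)%N)) /=.
  have := small j h (fun m : 'I_l.+1 => ~~ (j0 <= m)%N) jJ hH.
  have hs m : ~~ (j0 <= m)%N -> (m < l.+1)%N -> `|phi theta m| <= kappa'.
    rewrite -ltnNge => mj ml; rewrite leNgt; apply/negP => hm.
    by have := j0min m; rewrite hm andbT => /(_ ml); rewrite leqNgt mj.
  move=> /(_ (fun m hm => hs m hm (ltn_ord m))) + + ->; rewrite /c.
  move: (phase _ _) (\sum_(_ < _ | _) _) (\sum_(_ < _ | _) _) (delta * _) => x y z w.
  rewrite !ler_norml; lra.
(* By the choice of [x], the top coefficient times D is x times the top
   derivative. *)
have weylF : `|avg J (fun j => havg H l (fun h => cos ((F j).[h%:R] + c)))| <= e / 2.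
  apply: (hweyl H (ltnSn H0) _ _ mJ s (leq_subr _ _)).
    by move=> j; case: (tail_poly_size theta (A j)%:R j0s).
  move=> D D0 Ds c'.
  pose x := phi theta j0 * ('C(l, j0)%:R / l`!%:R) * D%:~R.
  have fl0 : 0 < l`!%:R :> R by rewrite ltr0n fact_gt0.
  have Cj0 : 1 <= 'C(l, j0)%:R :> R by rewrite ler1n bin_gt0.
  have D1 : 1 <= `|D%:~R| :> R.
    by rewrite -intr_norm ler1z; case: D D0 {Ds x} => [[|d]|d].
  have xlow : xm <= `|x|.
    rewrite xmE /x !normrM normfV [`|l`!%:R|]gtr0_norm// [`|'C(_, _)%:R|]ger0_norm//.
    have il0 : 0 <= l`!%:R^-1 :> R by rewrite invr_ge0 ltW.
    rewrite -mulrA; apply: (ler_pM (ltW kappa0) il0 j0k).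
    rewrite -[leLHS]mulr1; apply: (ler_pM il0 ler01 _ D1).
    by rewrite -[leLHS]mul1r ler_wpM2r.
  have xhigh : `|x| <= xM.
    rewrite xME /x !normrM normfV [`|l`!%:R|]gtr0_norm// [`|'C(_, _)%:R|]ger0_norm//.
    have il0 : 0 <= l`!%:R^-1 :> R by rewrite invr_ge0 ltW.
    have Cl : 'C(l, j0)%:R / l`!%:R <= l`!%:R :> R.
      rewrite ler_pdivrMr//; apply: le_trans (_ : l`!%:R * 1 <= _).
        by rewrite mulr1 ler_nat -(bin_fact j0l) leq_pmulr// muln_gt0 !fact_gt0.
      by rewrite ler_wpM2l ?(ltW fl0)// ler1n fact_gt0.
    have Dle : `|D%:~R| <= l`!%:R * H%:R ^+ l :> R.
      rewrite -intr_norm -abszE -pmulrn -natrX -natrM ler_nat.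
      apply: leq_trans Ds _; apply: leq_mul; first by rewrite leq_fact// leq_subr.
      by rewrite leq_pexp2l// leq_subr.
    have Cl0 : 0 <= 'C(l, j0)%:R / l`!%:R :> R by rewrite mulr_ge0.
    rewrite -mulrA; apply: (ler_pM (normr_ge0 _) (mulr_ge0 Cl0 (normr_ge0 _)) (norm_phi_le hth j0l)).
    exact: (ler_pM Cl0 (normr_ge0 _) Cl Dle).
  have x0 : 0 < `|x| by exact: lt_le_trans xlow.
  have avgE : `|avg J (fun j => cos ((F j)`_s * D%:~R + c')) -
      avg J (fun j => cos ((x * sg * u a1 + c') + j%:R * (x * sg * eta)))| <= ew / 2.
    apply: (mean_dist mJ) => j; apply: le_trans (cos_lipschitz _ _) _.
    have [_ ->] := tail_poly_size theta (A j)%:R j0s.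
    have [_ hAj] := hA j.
    have sg2 : sg * sg = 1.
      by rewrite -expr2 -real_normK ?num_real// sg1 expr1n.
    have -> : phi theta j0 * ('C(l, j0)%:R / l`!%:R) * f l (A j)%:R * D%:~R + c' -
       (x * sg * u a1 + c' + j%:R * (x * sg * eta)) =
       x * sg * (u (A j) - (u a1 + j%:R * eta)).
      rewrite /u /x; move: (phi _ _) ('C(_, _)%:R) (l`!%:R^-1) (D%:~R) => p1 p2 p3 p4.
      have -> : p1 * (p2 * p3) * f l (A j)%:R * p4 = p1 * (p2 * p3) * p4 * (sg * sg * f l (A j)%:R).
        by rewrite sg2; ring.
      ring.
    rewrite normrM [`|x * sg|]normrM sg1 mulr1; apply: le_trans rho1.
    exact: (ler_pM (normr_ge0 _) (normr_ge0 _) xhigh hAj).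
  have geo : `|avg J (fun j => cos ((x * sg * u a1 + c') + j%:R * (x * sg * eta)))| <= ew / 2.
    have nx : `|x * sg * eta| = `|x| * eta by rewrite normrM [`|x * sg|]normrM sg1 mulr1 (gtr0_norm eta0).
    apply: le_trans (avg_cos_arith _ _ _) _ => //.
      by rewrite nx mulr_gt0//= /eta ler_pdivrMr// mul1r.
    apply: le_trans hJ; rewrite nx ler_pM2l// lef_pV2 ?posrE ?mulr_gt0//.
    by rewrite ler_pM2l// ler_pM2r.
  move: avgE geo; move: (avg J _) (avg J _) => y z; rewrite !ler_norml; lra.
have : `|L (fun a => cos (phase theta a)) - avg J (fun j => havg H l (fun h => cos ((F j).[h%:R] + c)))|
    <= 2 * e1.
  have JS : L (fun a => cos (phase theta a)) = avg J (fun j => havg H l (fun h =>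
     if (j < J)%N && (h <= l * H)%N then cos (phase theta (A j + h)) else cos ((F j).[h%:R] + c))).
    by apply: avg_ext => j jJ; apply: havg_ext => h hH; rewrite jJ hH.
  rewrite JS; apply: (mean_dist mJ) => j; apply: (mean_dist mH) => h.
  case: ifPn => [/andP[jJ hH]|_]; first exact: mainE.
  by rewrite subrr normr0; lra.
move: weylF; move: (L _) (avg J _) => y z; rewrite !ler_norml; lra.
Qed.

End Scale.

Section ManyScales.
Variables (R : realType) (l n : nat) (f : nat -> R -> R) (X delta Theta : R) (a0 : nat).
Hypothesis Theta0 : 0 < Theta.
Hypothesis df : forall m x, (m <= l)%N -> X <= x -> is_derive x (1 : R) (f m) (f m.+1 x).
Hypothesis flim0 : forall e : R, 0 < e -> exists Y, forall x, Y <= x -> `|f l.+1 x| <= e.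
Variable sg : R.
Hypothesis sg1 : `|sg| = 1.
Hypothesis flimy : forall B : R, exists Y, forall x, Y <= x -> B <= sg * f l x.

Lemma supported_le a1 a2 a3 (L : (nat -> R) -> R) : (a2 <= a3)%N ->
  supported_on a1 a2 L -> supported_on a1 a3 L.
Proof.
move=> a23 sL u v uv; apply: sL => a /andP[a1a aa2]; apply: uv.
by rewrite a1a (leq_trans aa2).
Qed.

(** Add scales one at a time, the threshold kappa' of each being the kappa of
    the next. If phi_m lies between the two thresholds of the new scale, then
    m enters the sum on the left for good, which pays for the trivial bound
    -1; so at most l + 1 scales are lost. *)
Lemma many_scales (e : R) K : 0 < e ->
  exists L : (nat -> R) -> R, exists kappa : R, exists amax : nat,
  [/\ is_mean L, supported_on a0 amax L, 0 < kappa &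
    forall theta : 'I_n.+1 -> R, (forall i, `|theta i| <= Theta) ->
    - (K%:R * e + \sum_(m < l.+1) (kappa < `|phi theta m|)%R%:R) <=
    K%:R * L (fun a => cos (phase f delta theta a))].
Proof.
move=> e0; elim: K => [|K [L [k [amax [mL sL k0 hL]]]]].
  exists (fun u => u a0), 1, a0; split=> //.
  - by move=> u v; apply; rewrite leqnn.
  - by move=> theta _; rewrite !mul0r add0r oppr_le0 sumr_ge0.
have [L' [k' [amax' [mL' sL' /andP[k'0 k'k] hL']]]] :=
  @single_scale R l n f X delta Theta a0 Theta0 df flim0 sg sg1 flimy k e k0 e0.
have KR : K.+1%:R != 0 :> R by rewrite pnatr_eq0.
exists (fun u => (K%:R * L u + L' u) / K.+1%:R), k', (maxn amax amax'); split=> //.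
- split.
  + by move=> a u v; rewrite !mean_linear//; field; rewrite addrC natr1.
  + by move=> u u0; rewrite divr_ge0// addr_ge0 ?mulr_ge0//; apply: mean_ge0.
  + by rewrite !mean_one// mulr1 natr1 divff.
- move=> u v uv.
  have -> := supported_le (leq_maxl amax amax') sL uv.
  by have -> := supported_le (leq_maxr amax amax') sL' uv.
move=> theta hth.
rewrite [leRHS]mulrC divfK//; have := hL theta hth.
have lek (m : 'I_l.+1) : (k < `|phi theta m|)%R%:R <= (k' < `|phi theta m|)%R%:R :> R.
  by rewrite ler_nat; case: (ltP k) => // h; rewrite (le_lt_trans k'k h).
have lesum : \sum_(m < l.+1) (k < `|phi theta m|)%R%:R <=
    \sum_(m < l.+1) (k' < `|phi theta m|)%R%:R :> R by apply: ler_sum => m _.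
have [gap|] := pselect (forall m, (m <= l)%N -> `|phi theta m| <= k' \/ k <= `|phi theta m|).
  have := hL' theta hth gap; rewrite -natr1 mulrDl mul1r => h1 h2; lra.
move=> ngap.
have [m [ml [k'm mk]]] : exists m, (m <= l)%N /\ k' < `|phi theta m| /\ `|phi theta m| < k.
  apply: contrapT => nex; apply: ngap => m ml.
  have [h|h] := leP `|phi theta m| k'; first by left.
  right; rewrite leNgt; apply/negP => h'; apply: nex; by exists m.
have : 1 + \sum_(m < l.+1) (k < `|phi theta m|)%R%:R <=
    \sum_(m < l.+1) (k' < `|phi theta m|)%R%:R :> R.
  have ml' : (m < l.+1)%N by [].
  rewrite [X in 1 + X](bigD1 (Ordinal ml'))//= [leRHS](bigD1 (Ordinal ml'))//= k'm.
  by rewrite (ltNge k) (ltW mk)/= add0r lerD2l; apply: ler_sum.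
have : L' (fun=> -1) <= L' (fun a => cos (phase f delta theta a)).
  by apply: ler_mean => // a; exact: cos_geN1.
rewrite (mean_cst mL') -natr1 mulrDl mul1r => h1 h2 h3; lra.
Qed.

Lemma equidistribution (e : R) : 0 < e ->
  exists L : (nat -> R) -> R, exists amax : nat,
  [/\ is_mean L, supported_on a0 amax L &
    forall theta : 'I_n.+1 -> R, (forall i, `|theta i| <= Theta) ->
    - e <= L (fun a => cos (phase f delta theta a))].
Proof.
move=> e0; pose K := (Num.truncn (2 * l.+1%:R / e)).+1.
have K0 : 0 < K%:R :> R by rewrite ltr0n.
have hK : l.+1%:R <= K%:R * (e / 2).
  have : 2 * l.+1%:R / e <= K%:R by apply: ltW; exact: truncnS_gt.
  by rewrite ler_pdivrMr//; lra.
have e20 : 0 < e / 2 by lra.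
have [L [k [amax [mL sL k0 hL]]]] := many_scales K e20.
exists L, amax; split=> // theta hth.
have := hL theta hth.
have : \sum_(m < l.+1) (k < `|phi theta m|)%R%:R <= l.+1%:R :> R.
  apply: le_trans (_ : \sum_(m < l.+1) 1 <= _); last by rewrite sumr_const card_ord.
  by apply: ler_sum => m _; case: (_ < _).
move=> h1 h2; rewrite -(ler_pM2l K0) mulrN; lra.
Qed.

End ManyScales.

(** * Cosine polynomials concentrated near the differences of a set *)

Section CosinePolynomials.
Variables (R : realType) (n : nat).
Implicit Types (E : ('I_n -> R) -> R) (t w : 'I_n -> R).

Definition dot w t := \sum_i w i * t i.

Lemma dotD w w' t : dot (fun i => w i + w' i) t = dot w t + dot w' t.
Proof. by rewrite /dot -big_split /=; apply: eq_bigr => i _; rewrite mulrDl. Qed.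

Lemma dotB w w' t : dot (fun i => w i - w' i) t = dot w t - dot w' t.
Proof. by rewrite /dot -sumrB; apply: eq_bigr => i _; rewrite mulrBl. Qed.

(** Zero frequencies are allowed in the sum, so [z] is a lower bound for the
    constant coefficient; [z] and the bound [Om] on the frequencies are all
    that has to be followed through products. *)
Definition cos_poly (Om z : R) E := 0 <= z /\
  exists (Q : finType) (A : Q -> R) (w : Q -> 'I_n -> R),
  [/\ forall q, 0 <= A q, forall q i, `|w q i| <= Om &
      forall t, E t = z + \sum_q A q * cos (dot (w q) t)].

Lemma cos_poly1 Om : cos_poly Om 1 (fun=> 1).
Proof.
split=> //; exists 'I_0, (fun=> 0), (fun _ _ => 0); split=> [|[]//|t]//.
by rewrite big_ord0 addr0.
Qed.

(** Products of cosines are half sums of cosines of sums and differences. *)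
Lemma cos_polyM Om z E Om' z' E' : 0 <= Om -> 0 <= Om' ->
  cos_poly Om z E -> cos_poly Om' z' E' ->
  cos_poly (Om + Om') (z * z') (fun t => E t * E' t).
Proof.
move=> O0 O'0 [z0 [Q [A [w [A0 wO hE]]]]] [z'0 [Q' [A' [w' [A'0 w'O hE']]]]].
split; first exact: mulr_ge0.
exists (Q' + (Q + (Q * Q') * bool))%type.
exists (fun p => match p with inl q' => z * A' q' | inr (inl q) => z' * A q
  | inr (inr p) => A p.1.1 * A' p.1.2 / 2 end).
exists (fun p => match p with inl q' => w' q' | inr (inl q) => w q
  | inr (inr p) => fun i => if p.2 then w p.1.1 i + w' p.1.2 i else w p.1.1 i - w' p.1.2 i end).
split.
- by move=> [q'|[q|[[q q'] b]]] /=; rewrite ?divr_ge0// mulr_ge0.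
- move=> [q'|[q|[[q q'] b]]] i /=.
  + by apply: le_trans (w'O _ _) _; rewrite lerDr.
  + by apply: le_trans (wO _ _) _; rewrite lerDl.
  + case: b; [apply: le_trans (ler_normD _ _) _|apply: le_trans (ler_normB _ _) _];
    exact: lerD.
move=> t; rewrite hE hE' !big_sumType /=.
set S := \sum_q _; set S' := \sum_q' _.
have -> : \sum_q' z * A' q' * cos (dot (w' q') t) = z * S'.
  by rewrite mulr_sumr; apply: eq_bigr => q _; rewrite mulrA.
have -> : \sum_q z' * A q * cos (dot (w q) t) = z' * S.
  by rewrite mulr_sumr; apply: eq_bigr => q _; rewrite mulrA.
suff -> : \sum_(p : Q * Q' * bool) A p.1.1 * A' p.1.2 / 2 *
   cos (dot (fun i => if p.2 then w p.1.1 i + w' p.1.2 i else w p.1.1 i - w' p.1.2 i) t) =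
   S * S' by ring.
rewrite -(pair_bigA _ (fun (p : Q * Q') (b : bool) => A p.1 * A' p.2 / 2 *
   cos (dot (fun i => if b then w p.1 i + w' p.2 i else w p.1 i - w' p.2 i) t))) /=.
rewrite mulr_suml.
under [RHS]eq_bigr do rewrite mulr_sumr.
rewrite [RHS]pair_bigA /=. 
apply: eq_bigr => -[q q'] _ /=.
by rewrite big_bool /= dotD dotB cosD cosB; field.
Qed.

Lemma cos_poly_exp Om z E r : 0 <= Om -> cos_poly Om z E ->
  cos_poly (r%:R * Om) (z ^+ r) (fun t => E t ^+ r).
Proof.
move=> O0 hE; elim: r => [|r IH].
  by rewrite mul0r; exact: cos_poly1.
rewrite -natr1 mulrDl mul1r addrC exprS; under eq_fun do rewrite exprS.
by apply: cos_polyM => //; rewrite mulr_ge0.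
Qed.

Lemma cos_poly_prod Om z m (E : 'I_m -> ('I_n -> R) -> R) : 0 <= Om ->
  (forall i, cos_poly Om z (E i)) ->
  cos_poly (m%:R * Om) (z ^+ m) (fun t => \prod_i E i t).
Proof.
move=> O0; elim: m E => [|m IH] E hE.
  by under eq_fun do rewrite big_ord0; rewrite mul0r; exact: cos_poly1.
rewrite -natr1 mulrDl mul1r addrC exprS; under eq_fun do rewrite big_ord_recl.
by apply: cos_polyM => //; [rewrite mulr_ge0|apply: IH => i].
Qed.

Lemma cos_poly_coord Om z (Q : finType) (A w : Q -> R) (h : R -> R) i : 0 <= Om -> 0 <= z ->
  (forall q, 0 <= A q) -> (forall q, `|w q| <= Om) ->
  (forall x, h x = z + \sum_q A q * cos (w q * x)) ->
  cos_poly Om z (fun t => h (t i)).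
Proof.
move=> O0 z0 A0 wO hh; split=> //.
exists Q, A, (fun q j => if j == i then w q else 0); split=> //.
  by move=> q j; case: ifP => // _; rewrite normr0.
move=> t; rewrite hh; congr (_ + _); apply: eq_bigr => q _; congr (_ * cos _).
rewrite /dot (bigD1 i)//= eqxx big1 ?addr0// => j /negbTE ->.
by rewrite mul0r.
Qed.

(** The coefficients of the nonconstant terms add up to E(0) - z <= 1. *)
Lemma cos_poly_mean Om z E (L : (nat -> R) -> R) (t : nat -> 'I_n -> R) (e : R) :
  is_mean L -> 0 <= e -> cos_poly Om z E -> E (fun=> 0) <= 1 ->
  (forall w, (forall i, `|w i| <= Om) -> - e <= L (fun a => cos (dot w (t a)))) ->
  z - e <= L (fun a => E (t a)).
Proof.
move=> mL e0 [z0 [Q [A [w [A0 wO hE]]]]] E1 hL.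
have sA : \sum_q A q <= 1.
  apply: le_trans E1; rewrite hE; apply: le_trans (_ : \sum_q A q <= _) => //.
  have -> : \sum_q A q * cos (dot (w q) (fun=> 0)) = \sum_q A q.
    apply: eq_bigr => q _; rewrite (_ : dot _ _ = 0) ?cos0 ?mulr1//.
    by rewrite /dot big1// => i _; rewrite mulr0.
  by rewrite lerDr.
under eq_fun do rewrite hE.
rewrite (meanD mL) (mean_cst mL) (mean_sum mL) lerD2l.
apply: le_trans (_ : \sum_q A q * - e <= _).
  rewrite -mulr_suml mulrN lerN2; apply: le_trans (_ : 1 * e <= _); last by rewrite mul1r.
  by rewrite ler_wpM2r.
by apply: ler_sum => q _; rewrite (meanZ mL) ler_wpM2l// hL.
Qed.

End CosinePolynomials.

Section Kernel.
Variable R : realType.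

(** The binomial expansion of (exp(iy) + exp(-iy))^m. *)
Lemma cos_exp_expansion (y : R) m :
  (2 * cos y) ^+ m = \sum_(k < m.+1) 'C(m, k)%:R * cos ((2 * k%:R - m%:R) * y).
Proof.
elim: m => [|m IH].
  by rewrite expr0 big_ord_recr big_ord0 /= add0r mulr0 subrr mul0r cos0 mulr1.
rewrite exprSr IH mulr_suml.
pose u (k : nat) : R := cos ((2 * k%:R - m.+1%:R) * y).
have step (k : nat) : cos ((2 * k%:R - m%:R) * y) * (2 * cos y) = u k.+1 + u k.
  rewrite /u.
  have -> : (2 * k.+1%:R - m.+1%:R) * y = (2 * k%:R - m%:R) * y + y :> R.
    by rewrite -!natr1; ring.
  have -> : (2 * k%:R - m.+1%:R) * y = (2 * k%:R - m%:R) * y - y :> R.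
    by rewrite -!natr1; ring.
  by rewrite cosD cosB; ring.
under eq_bigr do rewrite -mulrA step mulrDr.
rewrite big_split /= [in RHS]big_ord_recl /=.
under [in RHS]eq_bigr do rewrite /bump /= add1n binS natrD mulrDl.
rewrite big_split /= [RHS]addrA [RHS]addrC; congr (_ + _).
rewrite big_ord_recl [in RHS]big_ord_recr/= (@bin_small m m.+1)// mul0r addr0 !bin0.
by congr (_ + _); apply: eq_bigr => k _; rewrite /bump /= add1n.
Qed.

(** Only polynomially small: in [exists_pattern] this loss is beaten by an
    exponential gain. *)
Lemma central_bin_ge Q : (4 ^ Q <= (2 * Q).+1 * 'C(2 * Q, Q))%N.
Proof.
elim: Q => [|Q IH]; first by rewrite muln0 bin0.
have h1 : (Q.+1 * 'C((2 * Q).+2, Q.+1) = (2 * Q).+2 * 'C((2 * Q).+1, Q))%N.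
  by rewrite mul_bin_diag.
have h2 : 'C((2 * Q).+1, Q) = 'C((2 * Q).+1, Q.+1).
  by rewrite -bin_sub; [congr ('C(_, _)); lia|lia].
have h3 : (Q.+1 * 'C((2 * Q).+1, Q.+1) = (2 * Q).+1 * 'C(2 * Q, Q))%N.
  by rewrite mul_bin_diag.
rewrite (_ : (2 * Q.+1 = (2 * Q).+2)%N); last lia.
rewrite expnS; rewrite -(@leq_pmul2l Q.+1)//.
move: h1 h2 h3 IH; move: 'C(_, _) 'C(_, _) 'C(_, _) 'C(_, _) (4 ^ Q)%N => a b c d e h1 h2 h3 IH.
nia.
Qed.

Lemma kernel_expansion Q (x : R) :
  ((1 + cos (2 * pi * x)) / 2) ^+ Q = 'C(2 * Q, Q)%:R / 4 ^+ Q +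
  \sum_(k < (2 * Q).+1) (if k == Q :> nat then 0 else 'C(2 * Q, k)%:R / 4 ^+ Q) *
     cos ((2 * pi * (k%:R - Q%:R)) * x).
Proof.
have -> : (1 + cos (2 * pi * x)) / 2 = (2 * cos (pi * x)) ^+ 2 / 4.
  have -> : 2 * pi * x = pi * x + pi * x by ring.
  rewrite cosD; have := cos2Dsin2 (pi * x).
  move=> h; have -> : sin (pi * x) * sin (pi * x) = 1 - cos (pi * x) ^+ 2 by rewrite -h; ring.
  by field.
rewrite expr_div_n -exprM cos_exp_expansion mulr_suml.
have hQ : (Q < (2 * Q).+1)%N by lia.
rewrite (bigD1 (Ordinal hQ))//= [in RHS](bigD1 (Ordinal hQ))//= eqxx mul0r add0r.
have term (k : nat) : 'C(2 * Q, k)%:R * cos ((2 * k%:R - (2 * Q)%N%:R) * (pi * x)) / 4 ^+ Q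
    = 'C(2 * Q, k)%:R / 4 ^+ Q * cos ((2 * pi * (k%:R - Q%:R)) * x) :> R.
  rewrite mulrAC natrM; congr (_ * cos _); ring.
rewrite term subrr mulr0 mul0r cos0 mulr1; congr (_ + _).
apply: eq_bigr => k kQ; rewrite term ifN//.
Qed.

Lemma kernel_cos_poly n Q (i : 'I_n) :
  cos_poly (2 * pi * Q%:R) ('C(2 * Q, Q)%:R / 4 ^+ Q)
    (fun t : 'I_n -> R => ((1 + cos (2 * pi * t i)) / 2) ^+ Q).
Proof.
have pi0 := pi_ge0 R.
apply: (cos_poly_coord i _ _ _ _ (kernel_expansion Q)).
- by rewrite !mulr_ge0.
- by rewrite divr_ge0// exprn_ge0.
- by move=> k; case: ifP => // _; rewrite divr_ge0// exprn_ge0.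
- move=> k; rewrite normrM ger0_norm ?mulr_ge0// ler_wpM2l ?mulr_ge0//.
  have : k%:R <= (2 * Q)%N%:R :> R by rewrite ler_nat -ltnS.
  have := ler0n R k; rewrite natrM ler_norml; lra.
Qed.

End Kernel.

Section Autocorrelation.
Variables (R : realType) (N K : nat) (F : {set 'I_N}) (P : nat -> Prop).
Hypothesis F0 : (0 < #|F|)%N.
Hypothesis K0 : (0 < K)%N.
Hypothesis FP : forall x y : 'I_N, x \in F -> y \in F -> (x < y)%N -> P (y - x)%N.

Let M := (N + K)%N.
Let w (xi : nat) : R := 2 * pi * xi%:R / M%:R.

Let M0 : 0 < M%:R :> R.
Proof. by rewrite ltr0n addn_gt0 K0 orbT. Qed.

(** The squared modulus of the discrete Fourier transform of [F] on Z/M,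
    normalised to have sum 1. *)
Definition acoef (xi : nat) : R :=
  ((\sum_(x in F) cos (w xi * x%:R)) ^+ 2 + (\sum_(x in F) sin (w xi * x%:R)) ^+ 2)
  / (M%:R * #|F|%:R).

Lemma acoef_ge0 xi : 0 <= acoef xi.
Proof. by rewrite divr_ge0// addr_ge0// sqr_ge0. Qed.

Lemma acoef0 : acoef 0 = #|F|%:R / M%:R.
Proof.
have F0' : #|F|%:R != 0 :> R by rewrite pnatr_eq0 -lt0n.
rewrite /acoef /w !mulr0 mul0r.
under eq_bigr do rewrite mul0r cos0.
under [in X in _ + X]eq_bigr do rewrite mul0r sin0.
rewrite sumr_const big1_eq expr0n addr0.
by field; rewrite F0' lt0r_neq0.
Qed.

Let D (u : R) := \sum_(xi < M) cos (w xi * u).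

Let D_opp u : D (- u) = D u.
Proof. by apply: eq_bigr => xi _; rewrite mulrN cosN. Qed.

Let sin_nat_period (u : nat) (y : R) : sin (2 * pi * u%:R + y) = sin y.
Proof.
elim: u => [|u IH]; first by rewrite mulr0 add0r.
rewrite -[RHS]IH -[u.+1%:R]natr1 mulrDr mulr1.
have -> : 2 * pi * u%:R + 2 * pi + y = (2 * pi * u%:R + y) + pi *+ 2 by rewrite mulr2n; ring.
by rewrite sinD2pi.
Qed.

Let D_nat (u : nat) : (0 < u < M)%N -> D u%:R = 0.
Proof.
move=> /andP[u0 uM].
pose x : R := 2 * pi * u%:R / M%:R.
have sx : 0 < sin (x / 2).
  apply: sin_gt0_pi; rewrite /x.
  have -> : 2 * pi * u%:R / M%:R / 2 = pi * (u%:R / M%:R) :> R by field; exact: lt0r_neq0 M0.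
  have ppi := pi_gt0 R.
  rewrite mulr_gt0//=; last by rewrite divr_gt0// ltr0n.
  by rewrite gtr_pMr// ltr_pdivrMr// mul1r ltr_nat.
have := sum_cos_arith 0 x M.
have -> : 0 + M%:R * x - x / 2 = 2 * pi * u%:R + - (x / 2).
  by rewrite /x; field; exact: lt0r_neq0 M0.
rewrite sin_nat_period sub0r subrr => /eqP; rewrite !mulf_eq0 pnatr_eq0/= (gt_eqF sx)/= => /eqP <-.
apply: eq_bigr => xi _; congr cos; rewrite add0r /w /x; field; exact: lt0r_neq0 M0.
Qed.

Let D0 : D 0 = M%:R.
Proof.
rewrite /D; under eq_bigr do rewrite mulr0 cos0.
by rewrite sumr_const card_ord.
Qed.

Lemma autocorrelation (m : R) :
  \sum_(xi < M) acoef xi * cos (w xi * m) =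
  (\sum_(x in F) \sum_(y in F) (D (x%:R - y%:R + m) + D (x%:R - y%:R - m))) / (2 * (M%:R * #|F|%:R)).
Proof.
have F0' : #|F|%:R != 0 :> R by rewrite pnatr_eq0 -lt0n.
have MF0 : M%:R * #|F|%:R != 0 :> R by rewrite mulf_neq0// lt0r_neq0.
have -> : \sum_(x in F) \sum_(y in F) (D (x%:R - y%:R + m) + D (x%:R - y%:R - m)) =
  \sum_(xi < M) \sum_(x in F) \sum_(y in F)
     (cos (w xi * (x%:R - y%:R + m)) + cos (w xi * (x%:R - y%:R - m))).
  rewrite [RHS]exchange_big /=; apply: eq_bigr => x _.
  rewrite [RHS]exchange_big /=; apply: eq_bigr => y _.
  by rewrite /D -big_split.
rewrite mulr_suml; apply: eq_bigr => xi _.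
have -> : \sum_(x in F) \sum_(y in F)
     (cos (w xi * (x%:R - y%:R + m)) + cos (w xi * (x%:R - y%:R - m))) =
  2 * cos (w xi * m) * ((\sum_(x in F) cos (w xi * x%:R)) ^+ 2 + (\sum_(x in F) sin (w xi * x%:R)) ^+ 2).
  rewrite !expr2 !mulr_suml -big_split /= mulr_sumr; apply: eq_bigr => x _.
  rewrite !mulr_sumr -big_split /= mulr_sumr; apply: eq_bigr => y _.
  rewrite mulrDr [w xi * (_ - _ - m)]mulrBr cosD cosB mulrBr cosB; ring.
by rewrite /acoef; field; rewrite F0' lt0r_neq0.
Qed.

Lemma acoef_sum : \sum_(xi < M) acoef xi = 1.
Proof.
have F0' : #|F|%:R != 0 :> R by rewrite pnatr_eq0 -lt0n.
have := autocorrelation 0; under eq_bigr do rewrite mulr0 cos0 mulr1.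
move=> ->.
have -> : \sum_(x in F) \sum_(y in F) (D (x%:R - y%:R + 0) + D (x%:R - y%:R - 0)) =
   \sum_(x in F) 2 * M%:R.
  apply: eq_bigr => x xF; rewrite (bigD1 x)//= big1 ?addr0.
    by rewrite subrr subr0 D0; ring.
  move=> y /andP[yF yx]; rewrite subr0 addr0.
  suff -> : D (x%:R - y%:R) = 0 by rewrite addr0.
  have [xy|yx'|e] := ltngtP x y; last by move: yx; rewrite (val_inj e) eqxx.
    rewrite -D_opp opprB -natrB ?(ltnW xy)//; apply: D_nat.
    by have := ltn_ord y; rewrite /M; lia.
  rewrite -natrB ?(ltnW yx')//; apply: D_nat.
  by have := ltn_ord x; rewrite /M; lia.
rewrite sumr_const -[_ *+ _]mulr_natr; field.
by rewrite F0' lt0r_neq0.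
Qed.

(** At an integer m the cosine polynomial is proportional to the number of
    pairs in F with a difference congruent to m or to - m modulo N + K; for 0
    < m <= K the congruence is an equality. *)
Lemma autocorrelation_eq0 (m : nat) : (0 < m <= K)%N -> ~ P m ->
  \sum_(xi < M) acoef xi * cos (w xi * m%:R) = 0.
Proof.
move=> /andP[m0 mK] nP.
have key (x y : 'I_N) : x \in F -> y \in F -> D (x%:R - y%:R + m%:R) = 0.
  move=> xF' yF'.
  have [lt|gt|e] := ltngtP (x + m)%N y.
  - have -> : x%:R - y%:R + m%:R = - (y - (x + m))%N%:R :> R.
      by rewrite natrB ?(ltnW lt)// natrD; ring.
    by rewrite D_opp; apply: D_nat; have := ltn_ord y; rewrite /M; lia.
  - have -> : x%:R - y%:R + m%:R = (x + m - y)%N%:R :> R.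
      by rewrite natrB ?(ltnW gt)// natrD; ring.
    by apply: D_nat; have := ltn_ord x; rewrite /M; lia.
  - exfalso; apply: nP; rewrite (_ : m = (y - x)%N); last by rewrite -e addKn.
    by apply: FP => //; rewrite -e; rewrite -[X in (X < _)%N]addn0 ltn_add2l.
rewrite autocorrelation big1 ?mul0r// => x xF; rewrite big1// => y yF.
rewrite key// (_ : x%:R - y%:R - m%:R = - (y%:R - x%:R + m%:R)); last by ring.
by rewrite D_opp key// addr0.
Qed.

(** At non-integers the polynomial is only an interpolation, but one with
    frequencies at most 1. *)
Lemma acorr_lipschitz (s t : R) :
  `|\sum_(xi < M) acoef xi * cos (w xi * s) - \sum_(xi < M) acoef xi * cos (w xi * t)|
   <= 2 * pi * `|s - t|.
Proof.
rewrite -sumrB; apply: le_trans (ler_norm_sum _ _ _) _.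
apply: le_trans (_ : \sum_(xi < M) acoef xi * (2 * pi * `|s - t|) <= _); last first.
  by rewrite -mulr_suml acoef_sum mul1r.
apply: ler_sum => xi _; rewrite -mulrBr normrM ger0_norm ?acoef_ge0//.
rewrite ler_wpM2l ?acoef_ge0//; apply: le_trans (cos_lipschitz _ _) _.
rewrite -mulrBr normrM ler_wpM2r//.
have ppi := pi_ge0 R.
rewrite /w ger0_norm ?divr_ge0 ?mulr_ge0// ler_pdivrMr// ler_wpM2l ?mulr_ge0//.
by rewrite ler_nat ltnW.
Qed.

Lemma acorr_cos_poly n (i : 'I_n) :
  cos_poly (2 * pi) (#|F|%:R / M%:R)
   (fun t : 'I_n -> R => \sum_(xi < M) acoef xi * cos (w xi * t i)).
Proof.
have ppi := pi_ge0 R.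
apply: (@cos_poly_coord _ _ _ _ 'I_M
   (fun xi => if xi == 0%N :> nat then 0 else acoef xi) (fun xi => w xi)
   (fun x => \sum_(xi < M) acoef xi * cos (w xi * x))).
- by rewrite mulr_ge0.
- by rewrite divr_ge0.
- by move=> q; case: ifP => // _; exact: acoef_ge0.
- move=> q; rewrite /w ger0_norm ?divr_ge0 ?mulr_ge0// ler_pdivrMr// ler_wpM2l ?mulr_ge0//.
  by rewrite ler_nat ltnW.
move=> x; have M0' : (0 < M)%N by rewrite addn_gt0 K0 orbT.
rewrite (bigD1 (Ordinal M0'))//= [in RHS](bigD1 (Ordinal M0'))//= mul0r add0r.
rewrite acoef0 {1}/w mulr0 mul0r mul0r cos0 mulr1; congr (_ + _).
by apply: eq_bigr => xi xi0; rewrite ifN.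
Qed.

End Autocorrelation.

(** * Thickness *)

Lemma exp_beats_poly kap d : exists r, (2 * (2 * (kap * r)).+1 ^ d <= 2 ^ r)%N.
Proof.
have [u uE] : exists u, u = (3 * d + kap + 2)%N by eexists.
exists (2 ^ (2 * u))%N.
have h1 : ((2 * (kap * 2 ^ (2 * u))).+1 <= 2 ^ (kap + 2 * u + 2))%N.
  move: (2 * u)%N => e; have := ltn_expl kap (ltnSn 1); rewrite !expnD; move: (2 ^ kap)%N => x kx.
  have : (0 < 2 ^ e)%N by rewrite expn_gt0.
  move: (2 ^ e)%N => y y0.
  have : (kap.+1 * y <= x * y)%N by rewrite leq_mul2r kx orbT.
  rewrite (_ : 2 ^ 2 = 4)%N// mulSn; move: (x * y)%N (kap * y)%N => z w; lia.
apply: leq_trans (_ : 2 * (2 ^ (kap + 2 * u + 2)) ^ d <= _)%N.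
  by rewrite leq_mul2l /=; case: (d) => // d'; rewrite leq_exp2r.
rewrite -expnM -expnS leq_exp2l// mulnC expnM.
have : (u < 2 ^ u)%N by exact: ltn_expl.
rewrite expnAC; move: (2 ^ u)%N => x ux.
apply: leq_trans (_ : (u.+1 ^ 2 <= _)%N); last by rewrite leq_exp2r.
nia.
Qed.

Section Thick.
Variables (R : realType) (l : nat) (f : nat -> R -> R) (X : R) (a0 : nat).
Hypothesis df : forall m x, (m <= l)%N -> X <= x -> is_derive x (1 : R) (f m) (f m.+1 x).
Hypothesis flim0 : forall e : R, 0 < e -> exists Y, forall x, Y <= x -> `|f l.+1 x| <= e.
Variable sg : R.
Hypothesis sg1 : `|sg| = 1.
Hypothesis flimy : forall B : R, exists Y, forall x, Y <= x -> B <= sg * f l x.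
Variables (M : nat -> Prop) (c : R).
Hypothesis c0 : 0 < c.
Hypothesis HF : forall N, exists F : {set 'I_N}, c * N%:R <= #|F|%:R /\
  forall x y : 'I_N, x \in F -> y \in F -> (x < y)%N -> M (y - x)%N.
Hypothesis f_ge1 : forall a, (a0 <= a)%N -> 1 <= f 0 a%:R.

Let c1 : c <= 1.
Proof.
have [F [cF _]] := HF 1; move: cF; rewrite mulr1 => /le_trans; apply.
by rewrite -[leRHS]/(1%:R) ler_nat -[X in (_ <= X)%N](card_ord 1) max_card.
Qed.

Definition bump (t : R) := (1 + cos (2 * pi * t)) / 2.

Lemma bump_ge0 t : 0 <= bump t.
Proof. by rewrite /bump; have := @cos_geN1 R (2 * pi * t); lra. Qed.

Lemma bump_le1 t : bump t <= 1.
Proof. by rewrite /bump; have := @cos_le1 R (2 * pi * t); lra. Qed.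

Lemma bump_period t (m : nat) : bump (t + m%:R) = bump t.
Proof.
rewrite /bump; congr ((1 + _) / 2); elim: m => [|m IH]; first by rewrite addr0.
rewrite -IH -[m.+1%:R]natr1 -[RHS]cosD2pi; congr cos; rewrite mulr2n; ring.
Qed.

Let angle_in (y : R) : 0 <= y -> y <= 1 / 2 -> 2 * pi * y \in `[0, pi].
Proof.
move=> y0 y1; have ppi := pi_ge0 R; rewrite in_itv/= !mulr_ge0//=.
have y2 : 0 <= 1 / 2 - y by lra.
by have := mulr_ge0 ppi y2; lra.
Qed.

Lemma bump_far d s : 0 <= d -> d <= s <= 1 - d -> bump s <= bump d.
Proof.
move=> d0 /andP[ds sd]; have ppi := pi_gt0 R.
wlog s2 : s ds sd / s <= 1 / 2.
  move=> h; have [/h|s2] := leP s (1 / 2); first exact.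
  have -> : bump s = bump (1 - s).
    rewrite /bump; congr ((1 + _) / 2).
    have -> : 2 * pi * s = - (2 * pi * (1 - s)) + pi *+ 2 by rewrite mulr2n; ring.
    by rewrite cosD2pi cosN.
  apply: h; lra.
rewrite /bump ler_pM2r ?invr_gt0// lerD2l.
have [->//|nsd] := eqVneq d s.
apply: ltW; rewrite ltr_cos.
- by rewrite ltr_pM2l ?mulr_gt0// lt_neqAle nsd.
- by apply: angle_in => //; exact: le_trans ds s2.
- by apply: angle_in => //; exact: le_trans d0 ds.
Qed.

Lemma bump_lt1 d : 0 < d <= 1 / 2 -> bump d < 1.
Proof.
move=> /andP[d0 d2]; have ppi := pi_gt0 R.
suff : cos (2 * pi * d) < 1 by rewrite /bump; lra.
rewrite -[ltRHS]cos0 ltr_cos.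
- by rewrite !mulr_gt0.
- by rewrite in_itv/= lexx ltW.
- by apply: angle_in => //; exact: ltW.
Qed.

(** Let E1 be the autocorrelation times the power kap of [bump]. If the
    integral part m of x is not in M, then |E1| is at most b at x - delta:
    close to m because the autocorrelation vanishes at m and is Lipschitz,
    elsewhere because [bump] is small. The r-th power of the product of the
    n+1 copies has constant term at least A^r / (2 kap r + 1)^(n+1) with A = 2
    b, which is at least 2 b^r for large r. An average that nearly annihilates
    all nonconstant cosines thus finds a point where the product is larger
    than b. *)
Lemma exists_pattern n : exists2 a, (a0 <= a)%N &
  forall i : 'I_n.+1, M (Num.truncn (f 0 (a + i)%N%:R)).
Proof.
have ppi := pi_gt0 R; have ppi2 := pi_ge2 R.
pose A := (c / 2) ^+ n.+1.
have A0 : 0 < A by rewrite exprn_gt0// divr_gt0.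
have A1 : A <= 1 / 2.
  rewrite /A exprS; apply: le_trans (_ : (1 / 2) * 1 <= _); last by rewrite mulr1.
  have c21 : 0 <= c / 2 <= 1 by have := c0; have := c1; lra.
  apply: ler_pM; [by case/andP: c21| |have := c1; lra|].
    by rewrite exprn_ge0//; case/andP: c21.
  by apply: exprn_ile1; case/andP: c21.
have [b [b0 b1 bE]] : exists b, [/\ 0 < b, b <= 1 / 4 & A = 2 * b].
  by exists (A / 2); split; [lra..|field].
(* Shifting by delta puts x - delta within delta of its integral part m as
   long as x is between m and m + 2 delta. *)
have [delta [d0 d1 dE]] : exists d : R, [/\ 0 < d, d <= 1 / 4 & 2 * pi * d = b].
  exists (b / (2 * pi)); split.
  - by rewrite divr_gt0// mulr_gt0.
  - by rewrite ler_pdivrMr ?mulr_gt0//; lra.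
  - by rewrite mulrC divfK// mulf_neq0// gt_eqF.
have [kap hkap] : exists kap, bump delta ^+ kap <= b.
  have q1 : `|bump delta| < 1 by rewrite ger0_norm ?bump_ge0// bump_lt1// d0; lra.
  have := cvg_expr q1 => /cvgr0_norm_le/(_ b b0)[k _ hk]; exists k.
  by apply: le_trans (hk k (leqnn k)); exact: ler_norm.
have [r hr] := exp_beats_poly kap n.+1.
have br0 : 0 < b ^+ r by rewrite exprn_gt0.
pose Q := (kap * r)%N.
pose Om : R := n.+1%:R * (r%:R * (2 * pi) + 2 * pi * Q%:R).
pose eta := b ^+ r / 2.
have eta0 : 0 < eta by rewrite divr_gt0.
have Om0 : 0 <= Om by rewrite mulr_ge0// addr_ge0// !mulr_ge0// ltW.
have Om1 : 0 < Om + 1 by lra.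
have [L [amax [mL sL hL]]] :=
  @equidistribution R l n f X delta (Om + 1) a0 Om1 df flim0 sg sg1 flimy eta eta0.
(* Only now, when the frequencies and the range of a are fixed, is the length
   of the set F chosen; the bounds obtained so far do not depend on it. *)
pose N := (\max_(a < amax.+1) \max_(i < n.+1) Num.truncn (f 0 (a + i)%N%:R)).+1.
have hN a i : (a <= amax)%N -> (i <= n)%N -> (Num.truncn (f 0 (a + i)%N%:R) <= N)%N.
  move=> ha hi; apply: leqW.
  have ha' : (a < amax.+1)%N by []. have hi' : (i < n.+1)%N by [].
  apply: leq_trans (@leq_bigmax _ (fun a : 'I_amax.+1 =>
     \max_(i < n.+1) Num.truncn (f 0 (a + i)%N%:R)) (Ordinal ha')).
  exact: (@leq_bigmax _ (fun i : 'I_n.+1 => Num.truncn (f 0 (a + i)%N%:R)) (Ordinal hi')).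
have N0 : (0 < N)%N by [].
have [F [cF dF]] := HF N.
have F0 : (0 < #|F|)%N.
  rewrite -(ltr_nat R); apply: lt_le_trans cF; rewrite mulr_gt0 ?ltr0n//.
pose C (t : R) := \sum_(xi < N + N) acoef R N F xi * cos (2 * pi * xi%:R / (N + N)%N%:R * t).
have C0 : C 0 = 1.
  by rewrite /C; under eq_bigr do rewrite mulr0 cos0 mulr1; exact: acoef_sum.
have Cle1 t : `|C t| <= 1.
  apply: le_trans (ler_norm_sum _ _ _) _; rewrite -(acoef_sum R F0 N0).
  apply: ler_sum => xi _; rewrite normrM ger0_norm ?acoef_ge0//.
  by rewrite ler_piMr ?acoef_ge0// cos_max.
pose E1 (t : R) := C t * bump t ^+ kap.
have E1le1 t : `|E1 t| <= 1.
  rewrite /E1 normrM mulr_ile1// normrX exprn_ile1// ger0_norm ?bump_ge0 ?bump_le1//.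
have E1good x : 1 <= x -> (Num.truncn x <= N)%N -> b < `|E1 (x - delta)| -> M (Num.truncn x).
  move=> x1 xN; apply: contraPP => nM; apply/negP; rewrite -leNgt.
  set m := Num.truncn x in xN nM *.
  have /andP[mx xm] : m%:R <= x < m.+1%:R by apply: truncn_itv; lra.
  have Cm : C m%:R = 0.
    apply: (@autocorrelation_eq0 R N N F M) => //; rewrite xN andbT.
    by rewrite /m truncn_gt0.
  pose s := x - delta - m%:R.
  have xE : x - delta = s + m%:R by rewrite /s; ring.
  rewrite /E1 normrM.
  have b1' : `|bump (x - delta) ^+ kap| <= 1.
    by rewrite normrX exprn_ile1// ger0_norm ?bump_ge0 ?bump_le1.
  have [sd|sd] := leP s delta.
    apply: le_trans (_ : b * 1 <= _); last by rewrite mulr1.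
    apply: ler_pM => //.
    have := @acorr_lipschitz R N N F F0 N0 (x - delta) m%:R.
    rewrite -/(C _) -/(C m%:R) Cm subr0 => /le_trans; apply.
    rewrite -dE ler_wpM2l ?mulr_ge0 ?(ltW ppi)//.
    by rewrite -/s ler_norml sd andbT /s; lra.
  apply: le_trans (_ : 1 * b <= _); last by rewrite mul1r.
  apply: ler_pM => //; rewrite normrX ger0_norm ?bump_ge0// xE bump_period.
  apply: le_trans hkap; apply: lerXn2r; rewrite ?nnegrE ?bump_ge0//.
  apply: bump_far; first exact: ltW.
  by rewrite (ltW sd)/= /s; move: xm; rewrite -natr1; lra.
pose E (t : 'I_n.+1 -> R) := \prod_(i < n.+1) (C (t i) ^+ r * bump (t i) ^+ Q).
have EE t : E t = (\prod_(i < n.+1) E1 (t i)) ^+ r.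
  by rewrite -prodrXl; apply: eq_bigr => i _; rewrite [in RHS]/E1 [in RHS]exprMn -exprM.
pose z : R := ((#|F|%:R / (N + N)%N%:R) ^+ r * ('C(2 * Q, Q)%:R / 4 ^+ Q)) ^+ n.+1.
have pi2 : 0 <= 2 * pi :> R by rewrite mulr_ge0// ltW.
have r2 : 0 <= r%:R * (2 * pi) :> R by rewrite mulr_ge0.
have Q2 : 0 <= 2 * pi * Q%:R :> R by rewrite mulr_ge0.
have Epoly : cos_poly Om z E.
  apply: cos_poly_prod => [|i]; first by rewrite addr_ge0.
  apply: cos_polyM => //; last exact: kernel_cos_poly.
  by apply: cos_poly_exp => //; exact: acorr_cos_poly.
have zbig : 2 * b ^+ r <= z.
  have NR : 0 < N%:R :> R by rewrite ltr0n.
  have z1 : c / 2 <= #|F|%:R / (N + N)%N%:R.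
    rewrite ler_pdivlMr ?ltr0n ?addn_gt0// natrD; lra.
  have z2 : (2 * Q).+1%:R^-1 <= 'C(2 * Q, Q)%:R / 4 ^+ Q :> R.
    rewrite ler_pdivlMr ?exprn_gt0// mulrC ler_pdivrMr// mulrC.
    by rewrite -natrX -natrM ler_nat central_bin_ge.
  have c20 : 0 <= c / 2 by have := c0; lra.
  apply: le_trans (_ : ((c / 2) ^+ r * (2 * Q).+1%:R^-1) ^+ n.+1 <= _); last first.
    have p1 : 0 <= (c / 2) ^+ r by rewrite exprn_ge0.
    have p2 : 0 <= (2 * Q).+1%:R^-1 :> R by rewrite invr_ge0.
    have p3 : (c / 2) ^+ r <= (#|F|%:R / (N + N)%N%:R) ^+ r.
      by apply: lerXn2r => //; rewrite nnegrE divr_ge0.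
    have p4 := ler_pM p1 p2 p3 z2.
    have p5 := mulr_ge0 p1 p2.
    by apply: lerXn2r => //; rewrite nnegrE; exact: le_trans p4.
  rewrite exprMn exprAC -/A bE exprMn [_ ^-1 ^+ _]exprVn ler_pdivlMr ?exprn_gt0//.
  rewrite mulrAC ler_pM2r//.
  by rewrite -!natrX -natrM ler_nat.
have Eat0 : E (fun=> 0) <= 1.
  rewrite EE big1 ?expr1n// => i _; rewrite /E1 C0 mul1r.
  by rewrite /bump mulr0 cos0 (_ : (1 + 1) / 2 = 1 :> R) ?expr1n//; field.
have mean_big : z - eta <= L (fun a => E (fun i => f 0 (a + i)%N%:R - delta)).
  apply: (cos_poly_mean mL (ltW eta0) Epoly Eat0) => w hw.
  by apply: hL => i; apply: le_trans (hw i) _; lra.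
have [a /andP[a0a aamax] Ea] : exists2 a, (a0 <= a <= amax)%N &
    b ^+ r < E (fun i => f 0 (a + i)%N%:R - delta).
  apply: contrapT => nex.
  have : L (fun a => E (fun i => f 0 (a + i)%N%:R - delta)) <= b ^+ r.
    rewrite -[leRHS](mean_cst mL).
    rewrite (_ : L (fun a => E _) = L (fun a =>
      if (a0 <= a <= amax)%N then E (fun i => f 0 (a + i)%N%:R - delta) else b ^+ r)).
      apply: ler_mean => // a; case: ifPn => // ha; rewrite leNgt; apply/negP => h.
      by apply: nex; exists a.
    by apply: sL => a ->.
  move: mean_big zbig br0; rewrite /eta; lra.
exists a => // i; apply: E1good.
- by apply: f_ge1; exact: leq_trans (leq_addr _ _).
- by apply: hN => //; rewrite -ltnS.
move: Ea; rewrite EE => Ea.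
have : b ^+ r < `|\prod_(i < n.+1) E1 (f 0 (a + i)%N%:R - delta)| ^+ r.
  by rewrite -normrX; apply: lt_le_trans Ea (ler_norm _).
rewrite normr_prod (bigD1 i)//= => Ei.
rewrite ltNge; apply/negP => Eib; move: Ei; apply/negP; rewrite -leNgt.
apply: lerXn2r; rewrite ?nnegrE ?mulr_ge0 ?prodr_ge0 ?(ltW b0)//.
rewrite -[leRHS]mulr1; apply: ler_pM => //; first exact: prodr_ge0.
by apply: prodr_ile1 => j _; rewrite normr_ge0 E1le1.
Qed.

End Thick.

Section HardyDerivatives.
Variable R : realType.

Lemma near_pinftyP (P : R -> Prop) : (\forall x \near +oo, P x) ->
  exists Y, forall x, Y <= x -> P x.
Proof.
move=> [Y [_ hY]]; exists (Y + 1) => x Yx; apply: hY; lra.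
Qed.

(** A Hardy field provides all derivatives on a half-line. [derive1n] is
    total, and agrees with them only where G agrees with a member of the
    field. *)
Lemma hardy_derivatives (G : R -> R) (l : nat) : germ_in_hardy_field G ->
  exists (f : nat -> R -> R) (X : R),
  (forall m x, (m <= l)%N -> X <= x -> is_derive x (1 : R) (f m) (f m.+1 x)) /\
  (forall m x, (m <= l.+1)%N -> X < x -> derive1n m G x = f m x).
Proof.
move=> [H [hH [f0 [Hf0 Gf0]]]].
have /choice[D hD] : forall h : R -> R, exists h' : R -> R, H h ->
    H h' /\ \forall x \near +oo, is_derive x (1 : R) h (h' x).
  move=> h; have [Hh|nHh] := pselect (H h); last by exists h.
  by have [h' hh'] := hardy_derive hH Hh; exists h'.
pose f m := iter m D f0.
have Hf m : H (f m) by elim: m => [//|m IH] /=; case: (hD (f m) IH).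
have /choice[Y hY] : forall m : nat, exists Y : R, forall x, Y <= x ->
    is_derive x (1 : R) (f m) (f m.+1 x).
  by move=> m; have [_ /near_pinftyP] := hD _ (Hf m).
have [Y0 hY0] := near_pinftyP Gf0.
pose X := Num.max Y0 (\big[Num.max/0]_(m < l.+1) Y m).
have XY0 : Y0 <= X by rewrite le_max lexx.
have XY m : (m <= l)%N -> Y m <= X.
  move=> ml; rewrite le_max; apply/orP; right.
  have ml' : (m < l.+1)%N by [].
  exact: (@le_bigmax _ _ _ 0 (fun m : 'I_l.+1 => Y m) (Ordinal ml')).
have dfX m x : (m <= l)%N -> X <= x -> is_derive x (1 : R) (f m) (f m.+1 x).
  by move=> ml Xx; apply: hY; apply: le_trans Xx; exact: XY.
exists f, X; split=> // m; elim: m => [|m IH] x ml Xx.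
  by rewrite derive1n0 hY0// (le_trans XY0)// ltW.
rewrite derive1nS derive1E.
have dfx := dfX m x ml (ltW Xx).
rewrite (@near_eq_derive _ _ _ (derive1n m G) (f m)).
  by rewrite derive_val.
near=> y; apply: IH; first exact: ltnW.
by near: y; exact: lt_nbhsr.
Unshelve. all: by end_near. Qed.

End HardyDerivatives.

Section Thickness.
Variables (R : realType) (g : nat -> R) (M : nat -> Prop) (c : R).
Hypothesis g_ge1 : forall n : nat, (0 < n)%N -> 1 <= g n.
Hypothesis c0 : 0 < c.
Hypothesis HF : forall N, exists F : {set 'I_N}, c * N%:R <= #|F|%:R /\
  forall x y : 'I_N, x \in F -> y \in F -> (x < y)%N -> M (y - x)%N.

(** The sign [sg] treats both infinite limits at once. *)
Lemma hardy_thick (G : R -> R) (l : nat) :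
  (forall n : nat, (0 < n)%N -> G n%:R = g n) ->
  germ_in_hardy_field G ->
  (derive1n l G x @[x --> +oo] --> +oo \/ derive1n l G x @[x --> +oo] --> -oo) ->
  derive1n l.+1 G x @[x --> +oo] --> 0 ->
  thick [set n | (0 < n)%N /\ M (intpart g n)].
Proof.
move=> Gg hG liml lim0 n n0.
have [f [X [df fG]]] := hardy_derivatives l hG.
have flim0 (e : R) : 0 < e -> exists Y, forall x, Y <= x -> `|f l.+1 x| <= e.
  move=> e0; move/cvgr0_norm_le : (lim0) => /(_ e e0)/near_pinftyP[Y hY].
  exists (Num.max Y (X + 1)) => x; rewrite ge_max => /andP[Yx Xx].
  by rewrite -fG//; [exact: hY|lra].
have [sg sg1 flimy] : exists2 sg : R, `|sg| = 1 &
    forall B : R, exists Y, forall x, Y <= x -> B <= sg * f l x.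
  case: liml => liml.
    exists 1; first by rewrite normr1.
    move=> B; have /near_pinftyP[Y hY] : \forall x \near +oo, B <= derive1n l G x.
      by move/cvgryPge : liml; exact.
    exists (Num.max Y (X + 1)) => x; rewrite ge_max => /andP[Yx Xx].
    by rewrite mul1r -fG//; [exact: hY|lra].
  exists (- 1); first by rewrite normrN1.
  move=> B; have /near_pinftyP[Y hY] : \forall x \near +oo, derive1n l G x <= - B.
    by move/cvgrNyPle : liml; exact.
  exists (Num.max Y (X + 1)) => x; rewrite ge_max => /andP[Yx Xx].
  by rewrite mulN1r -fG//; [rewrite lerNr; exact: hY|lra].
pose a0 := (Num.truncn X).+1.
have gE a : (a0 <= a)%N -> g a = f 0%N a%:R.
  move=> a0a; rewrite -fG//; last first.
    by apply: lt_le_trans (truncnS_gt X) _; rewrite ler_nat.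
  by rewrite derive1n0 Gg// (leq_trans _ a0a).
have f_ge1 a : (a0 <= a)%N -> 1 <= f 0%N a%:R.
  by move=> a0a; rewrite -gE// g_ge1// (leq_trans _ a0a).
have [a a0a Ma] := exists_pattern df flim0 sg1 flimy c0 HF f_ge1 n.
exists a; split; first exact: leq_trans a0a.
move=> i ni; split; first by rewrite addn_gt0 (leq_trans _ a0a).
have := Ma (Ordinal (ni : (i < n.+1)%N)) => /=.
by rewrite /intpart gE// (leq_trans a0a)// leq_addr.
Qed.

End Thickness.

(** * Density and thickness of the return times *)

Theorem theorem3p10 (R : realType) (g : nat -> R)
    (g_ge1 : forall n : nat, (0 < n)%N -> 1 <= g n)
    (g_erg : pointwise_ergodic R (intpart g))
    (k : nat) (k_gt0 : (0 < k)%N) (S_ : 'I_k -> set nat)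
    (S_pos : forall i : 'I_k, S_ i `<=` posN)
    (S_dens : forall i : 'I_k, 0 < upper_density R (S_ i)) :
  let Dg : set nat := \bigcap_(i in [set: 'I_k]) Delta2 g (S_ i) in
  let c : R := \prod_(i < k) upper_density R (S_ i) in
  (exists S : set nat,
     [/\ S `<=` posN,
         exists x : R, has_density S x /\ c <= x,
         Delta1 g S `<=` Dg
       & c <= upper_density R (Delta1 g S)]) /\
  (forall G : R -> R,
     (forall n : nat, (0 < n)%N -> G n%:R = g n) ->
     germ_in_hardy_field G ->
     forall l : nat,
       (derive1n l G x @[x --> +oo] --> +oo \/ derive1n l G x @[x --> +oo] --> -oo) ->
       derive1n l.+1 G x @[x --> +oo] --> 0 ->
       thick Dg).
Proof.
move=> Dg c.
pose M (m : nat) := forall i, 0 < upper_density R (S_ i `&` shift_down (S_ i) m).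
have c0 : 0 < c by apply: prodr_gt0 => i _; exact: S_dens.
have HF N : exists F : {set 'I_N}, c * N%:R <= #|F|%:R /\
    forall x y : 'I_N, x \in F -> y \in F -> (x < y)%N -> M (y - x)%N.
  exact: shrink_bigcap.
split.
  have [S [SN [x [dx cx]] SM cD]] := exists_return_set g_erg c0 HF.
  exists S; split=> //; first by exists x.
  move=> n [n0 [j [Sj [j0 Sja]]]] i _; split=> //; apply: (SM j _ Sj Sja) => //.
  by rewrite /intpart truncn_gt0 g_ge1.
move=> G Gg hG l liml lim0.
have thickM := hardy_thick g_ge1 c0 HF Gg hG liml lim0.
move=> n n0; have [a [a0 ha]] := thickM n n0.
by exists a; split=> // i /ha[ai Mi] j _; split.
Qed.
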